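(* Let $h:Z\to Z$ be a surjective local homeomorphism on a nonempty compact Hausdorff space $Z$, let $E$ be the topological graph $(Z,Z,\mathrm{id},h)$ with graph correspondence $X(E)$, and define $\alpha:\mathbb{R}\to\operatorname{Aut}\mathcal{O}(X(E))$ in terms of the gauge action $\gamma$ by $\alpha_t=\gamma_{e^{it}}$. Let $$\beta_c:=\limsup_{n\to\infty}\Big(n^{-1}\ln\Big(\max_{z\in Z}|h^{-n}(z)|\Big)\Big).$$ If there is a KMS state of $(\mathcal{O}(X(E)),\alpha)$ with inverse temperature $\beta$, then $\beta\le\beta_c$.
   Context: $|h^{-n}(z)|$ is the cardinality of the preimage of $z$ under $h^n$. The graph correspondence $X(E)$ of $E=(Z,Z,\mathrm{id},h)$ is the Hilbert bimodule over $C(Z)$ with underlying space $C(Z)$, module actions $(a\cdot x\cdot b)(z)=a(z)x(z)b(h(z))$, and inner product $\langle x,y\rangle(z)=\sum_{h(w)=z}\overline{x(w)}y(w)$. For a Hilbert bimodule $X$ over a $C^*$-algebra $A$ (right Hilbert $A$-module with left action $\varphi:A\to\mathcal{L}(X)$ by adjointable operators), a representation $(\psi,\pi)$ in a $C^*$-algebra $C$ is a linear map $\psi:X\to C$ and a homomorphism $\pi:A\to C$ with $\psi(a\cdot x\cdot b)=\pi(a)\psi(x)\pi(b)$ and $\pi(\langle x,y\rangle)=\psi(x)^*\psi(y)$. The Toeplitz algebra $\mathcal{T}(X)$ is generated by a universal representation $(\psi,\pi)$. With $\Theta_{x,y}(z)=x\cdot\langle y,z\rangle$ and $\mathcal{K}(X)=\overline{\operatorname{span}}\{\Theta_{x,y}\}$,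 there is a homomorphism $(\psi,\pi)^{(1)}:\mathcal{K}(X)\to\mathcal{T}(X)$ with $(\psi,\pi)^{(1)}(\Theta_{x,y})=\psi(x)\psi(y)^*$. The Cuntz-Pimsner algebra $\mathcal{O}(X)$ is the quotient of $\mathcal{T}(X)$ by the ideal generated by $\{\pi(a)-(\psi,\pi)^{(1)}(\varphi(a)):a\in A,\ \varphi(a)\in\mathcal{K}(X)\}$. The gauge action of $\mathbb{T}$ on $\mathcal{T}(X)$, characterised by $\gamma_z(\psi(x))=z\psi(x)$, $\gamma_z(\pi(a))=\pi(a)$, induces the gauge action $\gamma$ on $\mathcal{O}(X)$. For an action $\alpha$ of $\mathbb{R}$ on a $C^*$-algebra $B$, $a\in B$ is analytic if $t\mapsto\alpha_t(a)$ extends to an entire function $z\mapsto\alpha_z(a)$. A state $\phi$ of $B$ is a KMS state with inverse temperature $\beta$ of $(B,\alpha)$ if $\phi(ab)=\phi(b\,\alpha_{i\beta}(a))$ for all analytic $a,b$. *)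

(* Defs.v *)
From HB Require Import structures.
From mathcomp Require Import all_boot all_order all_algebra.
From mathcomp Require Import complex finmap.
From mathcomp Require Import all_classical all_reals.
From mathcomp Require Import ring.
From mathcomp Require Import topology normedtype sequences derive realfun exp trigo.
Set Implicit Arguments. Unset Strict Implicit. Unset Printing Implicit Defensive.
Import Order.TTheory GRing.Theory Num.Theory.
Import numFieldNormedType.Exports.
Local Open Scope classical_set_scope.
Local Open Scope ring_scope.
Local Open Scope complex_scope.

HB.instance Definition _ (R : realType) := NormedModule.copy R[i] R[i]^o.

Reserved Notation "a ** b" (at level 40, left associativity).

(* C*-algebras are not assumed unital. Norms over R[i] take their values in the
   nonnegative reals of R[i]. *)
HB.mixin Record isCStarAlgebra (R : realType) A & CompleteNormedModule R[i] A := {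
  cmul : A -> A -> A;
  cstar : A -> A;
  cmulA : associative cmul;
  cmulDl : left_distributive cmul +%R;
  cmulDr : right_distributive cmul +%R;
  cmulZl : forall (k : R[i]) a b, cmul (k *: a) b = k *: cmul a b;
  cmulZr : forall (k : R[i]) a b, cmul a (k *: b) = k *: cmul a b;
  cstarK : involutive cstar;
  cstarD : {morph cstar : a b / a + b};
  cstarZ : forall (k : R[i]) a, cstar (k *: a) = k^* *: cstar a;
  cstarM : forall a b, cstar (cmul a b) = cmul (cstar b) (cstar a);
  ler_norm_cmul : forall a b, `|cmul a b| <= `|a| * `|b|;
  norm_cstar_cmul : forall a, `|cmul (cstar a) a| = `|a| ^+ 2
}.

#[short(type="cstarAlgType")]
HB.structure Definition CStarAlgebra (R : realType) :=
  {A of isCStarAlgebra R A & CompleteNormedModule R[i] A}.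

Notation "a ** b" := (cmul a b) : ring_scope.

(* The inner product is linear in the second variable. Positivity of <x, x> is
   expressed as being of the form b^* b; its definiteness follows from
   norm_hinner. The left action is the *-homomorphism phi : A -> L(X), with
   phi(a^* ) the adjoint of phi(a) (hinner_lact). *)
HB.mixin Record isHilbertBimodule (R : realType) (A : cstarAlgType R) X
    & CompleteNormedModule R[i] X := {
  hlact : A -> X -> X;
  hract : X -> A -> X;
  hinner : X -> X -> A;
  hlactDl : forall a b x, hlact (a + b) x = hlact a x + hlact b x;
  hlactDr : forall a x y, hlact a (x + y) = hlact a x + hlact a y;
  hlactZl : forall (k : R[i]) a x, hlact (k *: a) x = k *: hlact a x;
  hlactZr : forall (k : R[i]) a x, hlact a (k *: x) = k *: hlact a x;
  hlactM : forall a b x, hlact (a ** b) x = hlact a (hlact b x);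
  hractDl : forall x y a, hract (x + y) a = hract x a + hract y a;
  hractDr : forall x a b, hract x (a + b) = hract x a + hract x b;
  hractZl : forall (k : R[i]) x a, hract (k *: x) a = k *: hract x a;
  hractZr : forall (k : R[i]) x a, hract x (k *: a) = k *: hract x a;
  hractM : forall x a b, hract x (a ** b) = hract (hract x a) b;
  hlactA : forall a x b, hract (hlact a x) b = hlact a (hract x b);
  hinnerDr : forall x y z, hinner x (y + z) = hinner x y + hinner x z;
  hinnerZr : forall (k : R[i]) x y, hinner x (k *: y) = k *: hinner x y;
  hinner_ract : forall x y a, hinner x (hract y a) = hinner x y ** a;
  hinner_star : forall x y, cstar (hinner x y) = hinner y x;
  hinner_ge0 : forall x, exists b : A, hinner x x = cstar b ** b;
  norm_hinner : forall x, `|hinner x x| = `|x| ^+ 2;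
  hinner_lact : forall a x y, hinner (hlact a x) y = hinner x (hlact (cstar a) y)
}.

#[short(type="hilbertBimodType")]
HB.structure Definition HilbertBimodule (R : realType) (A : cstarAlgType R) :=
  {X of isHilbertBimodule R A X & CompleteNormedModule R[i] X}.

Definition local_homeo (Z : topologicalType) (h : Z -> Z) :=
  forall z, exists U (g : Z -> Z),
    [/\ open U, U z, open (h @` U), {in U, cancel h g} &
        {within U, continuous h} /\ {within h @` U, continuous g}].

Section Fibres.
Variables (Z : topologicalType) (cZ : compact [set: Z]) (hZ : hausdorff_space Z).
Variables (h : Z -> Z) (hh : local_homeo h).

Lemma local_homeo_continuous : continuous h.
Proof.
move=> z; have [U [g [oU Uz _ _ [ch _]]]] := hh z.
by move: ch; rewrite continuous_open_subspace// => /(_ z); apply; rewrite inE.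
Qed.

Lemma local_homeo_finite_fibre z : finite_set (h @^-1` [set z]).
Proof.
pose T : ptopologicalType := HB.pack Z (isPointed.Build Z z).
have clF : closed (h @^-1` [set z]).
  apply: preimage_closed; first by move=> x _; exact: local_homeo_continuous.
  exact: accessible_closed_set1 (hausdorff_accessible hZ) z.
have cF : compact (h @^-1` [set z]) by exact: subclosed_compact clF cZ _.
have [U HU] := choice hh.
have : @compact T (h @^-1` [set z]) := cF.
rewrite compact_cover => /(_ Z setT U).
case=> [w _|w Fw|D _ FD].
- by have [g []] := HU w.
- by exists w => //; have [g []] := HU w.
have sub : h @^-1` [set z] `<=`
    \bigcup_(w in [set` D]) (U w `&` h @^-1` [set z]).
  by move=> w Fw; have [i Di Uw] := FD _ Fw; exists i.
apply: (sub_finite_set sub); apply: bigcup_finite; first exact: finite_fset.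
move=> i _; have [g [_ _ _ hg _]] := HU i.
apply: (@sub_finite_set _ _ [set g z] _ (finite_set1 (g z))).
by move=> w [Uw /= <-]; rewrite hg// inE.
Qed.

Lemma local_homeo_fibre_near z : exists g : Z -> Z -> Z,
  (forall w, h w = z -> (g w y @[y --> z] --> w)%classic) /\
  (\forall y \near z,
     set_bij (h @^-1` [set z]) (h @^-1` [set y]) (g ^~ y)).
Proof.
have [U /choice[g HU]] := choice hh.
exists g.
have gz w : h w = z -> g w z = w.
  by move=> hw; have [_ Uw _ hg _] := HU w; rewrite -hw hg// inE.
have gc w : h w = z -> (g w y @[y --> z] --> w).
  move=> hw; have [_ Uw oh hg [_ cg]] := HU w.
  move: cg; rewrite continuous_open_subspace// => /(_ z).
  move=> /(_ (mem_set (ex_intro2 _ _ w Uw hw))).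
  by rewrite /continuous_at gz.
split=> //.
have finF := local_homeo_finite_fibre z.
have inU : \forall y \near z, forall w, h w = z -> U w (g w y) /\ h (g w y) = y.
  have : nbhs z (\bigcap_(w in [set` fset_set (h @^-1` [set z])])
     [set y | U w (g w y) /\ h (g w y) = y]).
    apply: filter_bigI => w; rewrite in_fset_set// inE /= => hw.
    have [oU Uw oh hg _] := HU w.
    have : nbhs z (h @` U w) by apply: open_nbhs_nbhs; split=> //; exists w.
    by apply: filterS => _ [v Uv <-] /=; rewrite hg ?inE.
  by apply: filterS => y H w hw; apply: (H w); rewrite /= in_fset_set// inE.
have inj : \forall y \near z, forall w w', h w = z -> h w' = z ->
    g w y = g w' y -> w = w'.
  have : nbhs z (\bigcap_(w in [set` fset_set (h @^-1` [set z])])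
     [set y | forall w', h w' = z -> g w y = g w' y -> w = w']).
    apply: filter_bigI => w; rewrite in_fset_set// inE /= => hw.
    have : nbhs z (\bigcap_(w' in [set` fset_set (h @^-1` [set z])])
       [set y | g w y = g w' y -> w = w']).
      apply: filter_bigI => w'; rewrite in_fset_set// inE /= => hw'.
      have [->|/eqP ww'] := eqVneq w w'; first exact: nearW.
      move/eqP: ww' => ww'.
      have := hZ; rewrite open_hausdorff => /(_ _ _ ww')[[A B]] /=.
      rewrite !inE => -[Aw Bw'] [oA oB AB0].
      have HA := gc _ hw _ (open_nbhs_nbhs (conj oA Aw)).
      have HB := gc _ hw' _ (open_nbhs_nbhs (conj oB Bw')).
      near=> y => gy; exfalso.
      move/seteqP: AB0 => [/(_ (g w y)) + _]; apply.
      by split; [near: y|rewrite gy; near: y].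
    by apply: filterS => y H w' hw'; apply: (H w'); rewrite /= in_fset_set// inE.
  by apply: filterS => y H w w' hw; apply: (H w); rewrite /= in_fset_set// inE.
have surj : \forall y \near z, forall v, h v = y -> exists2 w, h w = z & U w v.
  pose V := \bigcup_(w in h @^-1` [set z]) U w.
  have oV : open V by apply: bigcup_open => w _; have [] := HU w.
  have clK : closed (h @` ~` V).
    apply: compact_closed => //; apply: continuous_compact.
      by apply: continuous_subspaceT; exact: local_homeo_continuous.
    by apply: subclosed_compact cZ _ => //; exact: open_closedC.
  have : nbhs z (~` (h @` ~` V)).
    apply: open_nbhs_nbhs; split; first exact: closed_openC.
    by move=> -[v nVv hv]; apply: nVv; exists v => //; have [] := HU v.
  apply: filterS => y H v hv.
  by apply: contrapT => nv; apply: H; exists v => // -[w]; move=> ? ?; apply: nv; exists w.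
near=> y.
have Hin : forall w, h w = z -> U w (g w y) /\ h (g w y) = y by near: y.
have Hinj : forall w w', h w = z -> h w' = z -> g w y = g w' y -> w = w' by near: y.
have Hs : forall v, h v = y -> exists2 w, h w = z & U w v by near: y.
split.
- by move=> w /= hw; by have [] := Hin w hw.
- move=> w w'; rewrite !inE => hw hw'; exact: Hinj.
- move=> v /= hv; have [w hw Uwv] := Hs v hv.
  exists w => //=; have [_ _ _ hg _] := HU w.
  by rewrite -hv hg// inE.
Unshelve. all: by end_near. Qed.

Lemma fibre_sum_continuous (K : numFieldType) (F : Z -> K) : continuous F ->
  continuous (fun z => \sum_(w \in h @^-1` [set z]) F w).
Proof.
move=> cF z; have [g [gc gb]] := local_homeo_fibre_near z.
have finF := local_homeo_finite_fibre z.
have Fz : (fun y => \sum_(w \in h @^-1` [set z]) F (g w y)) y @[y --> z]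
    --> \sum_(w \in h @^-1` [set z]) F w.
  pose S := fset_set (h @^-1` [set z]).
  have E (G : Z -> K) : \sum_(w \in h @^-1` [set z]) G w =
      \sum_(w <- S | w \in S) G w by rewrite fsbig_finite//= -big_seq.
  under eq_fun do rewrite E; rewrite E.
  apply: cvg_big => [|w]; first exact: add_continuous.
  rewrite in_fset_set// inE /= => hw.
  by apply: (@cvg_comp _ _ _ (g w) F); [exact: gc|exact: cF].
apply: cvg_trans Fz; apply: near_eq_cvg; near=> y.
have gby : set_bij (h @^-1` [set z]) (h @^-1` [set y]) (g ^~ y) by near: y.
by rewrite (reindex_fsbig _ _ _ _ gby).
Unshelve. all: by end_near. Qed.
End Fibres.

Section ComplexTopology.
Variable R : realType.
Implicit Types x y : R[i].

Definition rnorm x : R := complex.Re (`|x| : R[i]).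

Lemma complex_normE x : (rnorm x)%:C = `|x|.
Proof. by rewrite RRe_real// ger0_real. Qed.

Lemma ler_normRe x : `|complex.Re x| <= rnorm x.
Proof. by rewrite -lecR complex_normE normc_ge_Re. Qed.

Lemma ler_normIm x : `|complex.Im x| <= rnorm x.
Proof.
by rewrite -lecR complex_normE normc_def lecR -sqrtr_sqr ler_wsqrtr// lerDr sqr_ge0.
Qed.

Lemma ler_Re_norm x : rnorm x <= `|complex.Re x| + `|complex.Im x|.
Proof.
rewrite -lecR complex_normE rmorphD/= [x in `|x|]complexE.
rewrite (le_trans (ler_normD _ _))// normrM !normc_def/=.
by rewrite !expr0n !expr1n /= !addr0 add0r sqrtr1 mul1r !sqrtr_sqr.
Qed.

Lemma gt0_complexE (e : R[i]) : 0 < e -> 0 < complex.Re e /\ e = (complex.Re e)%:C.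
Proof.
move=> e0; have := RRe_real (gtr0_real e0) => <- /=; split=> //.
by move: e0; rewrite ltcE/= => /andP[].
Qed.

Lemma cvg_Re T (F : set_system T) (FF : Filter F) (f : T -> R[i]) x :
  f @ F --> x -> (complex.Re (f t) @[t --> F] --> (complex.Re x : R)).
Proof.
move/cvgrPdist_lt => fx; apply/cvgrPdist_lt => e e0.
have := fx e%:C; rewrite ltcR => /(_ e0); apply: filterS => t.
rewrite -complex_normE ltcR; apply: le_lt_trans.
by rewrite -raddfB/= ler_normRe.
Qed.

Lemma cvg_conjc T (F : set_system T) (FF : Filter F) (f : T -> R[i]) x :
  f @ F --> x -> (f t)^* @[t --> F] --> x^*.
Proof.
move/cvgrPdist_lt => fx; apply/cvgrPdist_lt => e e0.
by apply: filterS (fx e e0) => t; rewrite -rmorphB normcJ.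
Qed.

Lemma cvg_complex T (F : set_system T) (FF : Filter F) (f : T -> R[i]) x :
  (complex.Re (f t) @[t --> F] --> (complex.Re x : R)) ->
  (complex.Im (f t) @[t --> F] --> (complex.Im x : R)) ->
  f @ F --> x.
Proof.
move=> /cvgrPdist_lt aF /cvgrPdist_lt bF.
apply/cvgrPdist_lt => e /gt0_complexE[e0 ->].
have e20 : 0 < complex.Re e / 2 by rewrite divr_gt0.
near=> t; rewrite -complex_normE ltcR (le_lt_trans (ler_Re_norm _))//.
rewrite [ltRHS]splitr raddfB/=.
have -> : complex.Im (x - f t) = complex.Im x - complex.Im (f t).
  by move: (f t) => [? ?]; case: (x).
by apply: ltrD; near: t; [exact: aF|exact: bF].
Unshelve. all: by end_near. Qed.

Lemma complex_complete (F : set_system R[i]) :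
  ProperFilter F -> cauchy F -> cvg F.
Proof.
move=> FF /cauchy_ballP Fc.
have proj_cauchy (p : R[i] -> R) : (forall x y, `|p x - p y| <= rnorm (x - y)) ->
    cvg (p @ F).
  move=> pl; apply: cauchy_cvg; apply/cauchy_ballP => e e0.
  have := Fc e%:C; rewrite ltcR => /(_ e0) [[A B] [/= FA FB] AB].
  exists (p @` A, p @` B) => /=; first split.
  - by apply: filterS FA => x; exists x.
  - by apply: filterS FB => x; exists x.
  move=> [_ _] [/= [x Ax <-] [y By <-]].
  have /AB : (A `*` B) (x, y) by [].
  by rewrite /ball/= -complex_normE ltcR; apply: le_lt_trans.
have /cvg_ex[a aF] : cvg (@complex.Re R @ F).
  by apply: proj_cauchy => x y; rewrite -raddfB/= ler_normRe.
have /cvg_ex[b bF] : cvg (@complex.Im R @ F).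
  apply: proj_cauchy => x y; rewrite (_ : complex.Im x - complex.Im y = complex.Im (x - y)).
    exact: ler_normIm.
  by case: x y => [? ?] [].
apply/cvg_ex; exists (a +i* b).
exact: (@cvg_complex _ F _ id).
Qed.

HB.instance Definition _ := Uniform_isComplete.Build R[i] complex_complete.
End ComplexTopology.

(* C(Z); the proof of compactness is a parameter of the type so that the
   supremum norm can be attached to it. *)
Definition cfun (R : realType) (Z : topologicalType) (cZ : compact [set: Z]) :
  Type := continuousType Z R[i].

Section CFun.
Variables (R : realType) (Z : topologicalType) (cZ : compact [set: Z]).
Local Notation C := (cfun R cZ).
Implicit Types (f g : C) (k : R[i]).

Definition mkcfun (f : Z -> R[i]) (cf : continuous f) : C := mkcts cf.

HB.instance Definition _ := gen_eqMixin C.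
HB.instance Definition _ := gen_choiceMixin C.

Lemma cfunP f g : f = g <-> f =1 g. Proof. exact: continuousEP. Qed.
Lemma cfun_cts f : continuous f. Proof. exact: cts_fun. Qed.

Let add_cts f g : continuous (fun z => f z + g z).
Proof. by move=> z; apply: cvgD; exact: cfun_cts. Qed.
Let opp_cts f : continuous (fun z => - f z).
Proof. by move=> z; apply: cvgN; exact: cfun_cts. Qed.
Let mul_cts f g : continuous (fun z => f z * g z).
Proof. by move=> z; apply: cvgM; exact: cfun_cts. Qed.
Let scale_cts k f : continuous (fun z => k * f z).
Proof. by move=> z; apply: cvgM; [exact: cvg_cst|exact: cfun_cts]. Qed.
Let cst_cts k : continuous (fun _ : Z => k).
Proof. by move=> z; exact: cvg_cst. Qed.
Let conj_cts f : continuous (fun z => (f z)^*).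
Proof.
by move=> z; apply: cvg_conjc; exact: cfun_cts. Qed.

Definition cfun_cst k : C := mkcfun (@cst_cts k).
Definition cfun_add f g : C := mkcfun (@add_cts f g).
Definition cfun_opp f : C := mkcfun (@opp_cts f).
Definition cfun_mul f g : C := mkcfun (@mul_cts f g).
Definition cfun_scale k f : C := mkcfun (@scale_cts k f).
Definition cfun_conj f : C := mkcfun (@conj_cts f).

HB.instance Definition _ := isPointed.Build C (cfun_cst 0).

Let addA : associative cfun_add.
Proof. by move=> f g k; apply/cfunP => z; exact: addrA. Qed.
Let addC : commutative cfun_add.
Proof. by move=> f g; apply/cfunP => z; exact: addrC. Qed.
Let add0 : left_id (cfun_cst 0) cfun_add.
Proof. by move=> f; apply/cfunP => z; exact: add0r. Qed.
Let addN : left_inverse (cfun_cst 0) cfun_opp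
  cfun_add.
Proof. by move=> f; apply/cfunP => z; exact: addNr. Qed.

HB.instance Definition _ := GRing.isZmodule.Build C addA addC add0 addN.

Let scaleA (a b : R[i]) f : cfun_scale a (cfun_scale b f) =
  cfun_scale (a * b) f.
Proof. by apply/cfunP => z; exact: mulrA. Qed.
Let scale1 : left_id 1 cfun_scale.
Proof. by move=> f; apply/cfunP => z; exact: mul1r. Qed.
Let scaleDr : right_distributive cfun_scale +%R.
Proof. by move=> k f g; apply/cfunP => z; exact: mulrDr. Qed.
Let scaleDl f : {morph (cfun_scale ^~ f) : a b / a + b}.
Proof. by move=> a b; apply/cfunP => z; exact: mulrDl. Qed.

HB.instance Definition _ :=
  GRing.Zmodule_isLmodule.Build R[i] C scaleA scale1 scaleDr scaleDl.

Lemma cfunDE f g z : (f + g) z = f z + g z. Proof. by []. Qed.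
Lemma cfunNE f z : (- f) z = - f z. Proof. by []. Qed.
Lemma cfunBE f g z : (f - g) z = f z - g z. Proof. by []. Qed.
Lemma cfunZE k f z : (k *: f) z = k * f z. Proof. by []. Qed.
Lemma cfun0E z : (0 : C) z = 0. Proof. by []. Qed.

Lemma cfun_bounded f : exists M : R, forall z, rnorm (f z) <= M.
Proof.
have cts : continuous (fun z => rnorm (f z)).
  move=> z; apply: cvg_Re; apply: cvg_norm; exact: cfun_cts.
have := continuous_compact (continuous_subspaceT cts) cZ.
move=> /(@compact_bounded R R) /=.
rewrite /bounded_set /= => -[M [_ HM]].
exists (M + 1) => z.
by apply: le_trans (ler_norm _) (HM _ _ _ _); [rewrite ltrDl|exists z].
Qed.

Definition cnorm f : R := sup (range (fun z => rnorm (f z))).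

Lemma ler_cnorm f z : `|f z| <= (cnorm f)%:C.
Proof.
rewrite -complex_normE lecR; apply: ub_le_sup; last by exists z.
by have [M HM] := cfun_bounded f; exists M => _ [x _ <-].
Qed.

Lemma cnorm_empty f : [set: Z] = set0 -> cnorm f = 0.
Proof.
rewrite /cnorm => E; have -> : range (fun z => rnorm (f z)) = set0.
  by rewrite -subset0 => r [x + _]; rewrite E.
by rewrite sup0.
Qed.

Lemma cnorm_ge0 f : 0 <= cnorm f.
Proof.
have [/cnorm_empty->//|/set0P[z _]] := eqVneq [set: Z] set0.
by rewrite -lecR (le_trans _ (ler_cnorm f z)).
Qed.

Lemma cnorm_le f (e : R) : 0 <= e -> (forall z, `|f z| <= e%:C) -> cnorm f <= e.
Proof.
move=> e0 fe; have [/cnorm_empty->//|/set0P[z _]] := eqVneq [set: Z] set0.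
apply: ge_sup; first by exists (rnorm (f z)), z.
by move=> _ [x _ <-]; rewrite -lecR complex_normE.
Qed.

Let normD f g : (cnorm (f + g))%:C <= (cnorm f)%:C + (cnorm g)%:C.
Proof.
rewrite -rmorphD/= lecR; apply: cnorm_le => [|z]; first exact: addr_ge0 (cnorm_ge0 _) (cnorm_ge0 _).
rewrite cfunDE (le_trans (ler_normD _ _))// rmorphD/=.
by apply: lerD; exact: ler_cnorm.
Qed.

Let normZ k f : (cnorm (k *: f))%:C = `|k| * (cnorm f)%:C.
Proof.
have H a g : cnorm (a *: g) <= rnorm a * cnorm g.
  have ra : 0 <= rnorm a by rewrite -ler0c complex_normE.
  apply: cnorm_le => [|z]; first by rewrite mulr_ge0 ?cnorm_ge0.
  rewrite cfunZE normrM rmorphM/= complex_normE.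
  by apply: ler_wpM2l => //; exact: ler_cnorm.
rewrite -complex_normE -rmorphM/=; congr (_%:C).
apply/eqP; rewrite eq_le H/=.
have [->|k0] := eqVneq k 0.
  by rewrite {1}/rnorm normr0 mul0r cnorm_ge0.
have := H k^-1 (k *: f); rewrite scalerA mulVf// scale1r.
have rk : 0 < rnorm k by rewrite -ltcR complex_normE; rewrite normr_gt0.
have -> : rnorm k^-1 = (rnorm k)^-1.
  by apply: complexI; rewrite complex_normE fmorphV/= complex_normE normfV.
by rewrite mulrC ler_pdivlMr// mulrC.
Qed.

Let norm0_eq0 f : (cnorm f)%:C = 0 -> f = 0.
Proof.
move=> f0; apply/cfunP => z; apply/eqP; rewrite cfun0E -normr_le0.
by rewrite -[leRHS]f0 ler_cnorm.
Qed.

HB.instance Definition _ := @Lmodule_isNormed.Build R[i] C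
  (fun f => (cnorm f)%:C) normD normZ norm0_eq0.

Lemma cfun_normE f : `|f| = (cnorm f)%:C :> R[i]. Proof. by []. Qed.

Lemma ler_cfun_norm f z : `|f z| <= `|f|. Proof. exact: ler_cnorm. Qed.

Lemma cfun_norm_le f (e : R[i]) : 0 <= e -> (forall z, `|f z| <= e) -> `|f| <= e.
Proof.
move=> e0 fe; rewrite cfun_normE -(RRe_real (ger0_real e0)) lecR.
apply: cnorm_le => [|z]; last by rewrite (RRe_real (ger0_real e0)).
by rewrite -ler0c (RRe_real (ger0_real e0)).
Qed.

Lemma cfun_complete (F : set_system C) : ProperFilter F -> cauchy F -> cvg F.
Proof.
move=> FF /cauchy_ballP Fc.
have ev z : cvg ((fun f : C => f z) @ F).
  apply: cauchy_cvg; apply/cauchy_ballP => e e0.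
  have [[A B] [/= FA FB] AB] := Fc e e0.
  exists ((fun f : C => f z) @` A, (fun f : C => f z) @` B) => /=; first split.
  - by apply: filterS FA => f; exists f.
  - by apply: filterS FB => f; exists f.
  move=> [_ _] [/= [f Af <-] [g Bg <-]].
  have /AB : (A `*` B) (f, g) by [].
  rewrite -!ball_normE/= => fg; apply: le_lt_trans fg.
  exact: (ler_cfun_norm (f - g)).
pose l z := lim ((fun f : C => f z) @ F).
have Fl e : 0 < e -> \forall f \near F, forall z, `|l z - (f : C) z| <= e.
  move=> e0; have [[A B] [/= FA FB] AB] := Fc e e0.
  apply: filterS FB => g Bg z.
  have /cvgrPdist_lt evz : (fun f : C => f z) @ F --> l z := ev z.
  apply/ler_addgt0Pr => d d0; near F => f.
  have : (A `*` B) (f, g) by split=> //; near: f.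
  move/AB; rewrite -ball_normE/= => fg.
  rewrite -(subrK (f z) (l z)) -addrA (le_trans (ler_normD _ _))// [leRHS]addrC.
  apply: lerD; last by apply: le_trans (ltW fg); exact: (ler_cfun_norm (f - g)).
  by apply: ltW; near: f; exact: evz.
have cl : continuous l.
  move=> z; apply/cvgrPdist_lt => e e0.
  have e3 : 0 < e / 3 by rewrite divr_gt0.
  have [f lf] := @filter_ex _ F FF _ (Fl _ e3).
  have /cvgrPdist_lt/(_ _ e3) fz := @cfun_cts f z.
  apply: filterS fz => t ft.
  have -> : l z - l t = (l z - f z) + ((f z - f t) - (l t - f t)).
    by ring.
  rewrite (le_lt_trans (ler_normD _ _))//.
  have -> : e = e / 3 + (e / 3 + e / 3) by field.
  apply: ler_ltD => //; rewrite (le_lt_trans (ler_normB _ _))//.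
  exact: ltr_leD.
apply/cvg_ex; exists (mkcfun cl); apply/cvgrPdist_le => e e0.
apply: filterS (Fl e e0) => f lf.
by apply: cfun_norm_le => //; exact: ltW.
Unshelve. all: by end_near. Qed.

HB.instance Definition _ := Uniform_isComplete.Build C cfun_complete.

Let cmA : associative cfun_mul.
Proof. by move=> f g k; apply/cfunP => z; exact: mulrA. Qed.
Let cmDl : left_distributive cfun_mul +%R.
Proof. by move=> f g k; apply/cfunP => z; exact: mulrDl. Qed.
Let cmDr : right_distributive cfun_mul +%R.
Proof. by move=> f g k; apply/cfunP => z; exact: mulrDr. Qed.
Let cmZl k f g : cfun_mul (k *: f) g = k *: cfun_mul f g.
Proof. by apply/cfunP => z; apply/esym; exact: mulrA. Qed.
Let cmZr k f g : cfun_mul f (k *: g) = k *: cfun_mul f g.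
Proof. by apply/cfunP => z; exact: mulrCA. Qed.
Let csK : involutive cfun_conj.
Proof. by move=> f; apply/cfunP => z; exact: conjcK. Qed.
Let csD : {morph cfun_conj : f g / f + g}.
Proof. by move=> f g; apply/cfunP => z; exact: rmorphD. Qed.
Let csZ k f : cfun_conj (k *: f) = k^* *: cfun_conj f.
Proof. by apply/cfunP => z; exact: rmorphM. Qed.
Let csM f g : cfun_conj (cfun_mul f g) = cfun_mul (cfun_conj g) (cfun_conj f).
Proof.
by apply/cfunP => z; rewrite [RHS]mulrC; exact: rmorphM.
Qed.
Let cn_mul f g : `|cfun_mul f g| <= `|f| * `|g|.
Proof.
apply: cfun_norm_le => [|z]; first exact: mulr_ge0.
by rewrite normrM ler_pM//; exact: ler_cfun_norm.
Qed.
Let cn_star f : `|cfun_mul (cfun_conj f) f| = `|f| ^+ 2.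
Proof.
have n0 : 0 <= `|cfun_mul (cfun_conj f) f| by exact: normr_ge0.
apply/eqP; rewrite eq_le; apply/andP; split.
  apply: cfun_norm_le => [|z]; first exact: exprn_ge0.
  by rewrite normrM normcJ expr2 ler_pM//; exact: ler_cfun_norm.
suff : `|f| <= sqrtC `|cfun_mul (cfun_conj f) f|.
  by move=> H; rewrite -[leRHS]sqrtCK lerXn2r ?nnegrE// sqrtC_ge0.
apply: cfun_norm_le => [|z]; first by rewrite sqrtC_ge0.
rewrite -(@ler_pXn2r _ 2)// ?nnegrE ?sqrtC_ge0// sqrtCK.
apply: le_trans (ler_cfun_norm _ z).
by rewrite normrM normcJ expr2.
Qed.

HB.instance Definition _ := isCStarAlgebra.Build R C cmA cmDl cmDr cmZl cmZr
  csK csD csZ csM cn_mul cn_star.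

End CFun.

(* The correspondence X(E) of E = (Z, Z, id, h): the space C(Z) again, but
   normed by the square root of the norm of <x, x>. Compactness, separation and
   the local homeomorphism property are parameters of the type because they make
   the fibre sums finite and continuous. *)
Definition graph_corr (R : realType) (Z : topologicalType)
  (cZ : compact [set: Z]) (hZ : hausdorff_space Z)
  (h : Z -> Z) (hh : local_homeo h) : Type := cfun R cZ.

Section GraphCorrespondence.
Variables (R : realType) (Z : topologicalType).
Variables (cZ : compact [set: Z]) (hZ : hausdorff_space Z).
Variables (h : Z -> Z) (hh : local_homeo h).
Local Notation C := (cfun R cZ).
Local Notation X := (graph_corr R cZ hZ hh).
Implicit Types (x y : X) (a b : C) (k : R[i]).

HB.instance Definition _ := GRing.Lmodule.copy X C.

Let ract_cts (x : C) b : continuous (fun z => x z * b (h z)).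
Proof.
move=> z; apply: cvgM; first exact: cfun_cts.
apply: (@cvg_comp _ _ _ h b); last exact: cfun_cts.
exact: (local_homeo_continuous hh).
Qed.

Let inner_cts (x y : C) :
  continuous (fun z => \sum_(w \in h @^-1` [set z]) (x w)^* * y w).
Proof.
apply: (fibre_sum_continuous cZ hZ hh (F := fun w => (x w)^* * y w)) => w.
by apply: cvgM; [apply: cvg_conjc|]; exact: cfun_cts.
Qed.

Definition gc_lact a x : X := cfun_mul a x.
Definition gc_ract x b : X := mkcfun cZ (@ract_cts x b).
Definition gc_inner x y : C := mkcfun cZ (@inner_cts x y).

Let fibre z := fset_set (h @^-1` [set z]).

Lemma fibre_sumE (K : numFieldType) (F : Z -> K) z :
  \sum_(w \in h @^-1` [set z]) F w = \sum_(w <- fibre z) F w.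
Proof. by rewrite fsbig_finite//; exact: local_homeo_finite_fibre. Qed.

Lemma fibre_sum_eq (K : numFieldType) (F G : Z -> K) z :
  (forall w, h w = z -> F w = G w) ->
  \sum_(w \in h @^-1` [set z]) F w = \sum_(w \in h @^-1` [set z]) G w.
Proof. by move=> FG; apply: eq_fsbigr => w; rewrite inE; exact: FG. Qed.

Definition fsq x z : R := \sum_(w <- fibre z) rnorm (x w) ^+ 2.

Lemma fsqE x z : gc_inner x x z = (fsq x z)%:C.
Proof.
rewrite /fsq rmorph_sum/= -fibre_sumE; apply: fibre_sum_eq => w _.
by rewrite rmorphXn/= complex_normE sqr_normc mulrC.
Qed.

Lemma fsq_ge0 x z : 0 <= fsq x z.
Proof. by apply: sumr_ge0 => w _; exact: sqr_ge0. Qed.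

Definition gnorm x : R := Num.sqrt (cnorm (gc_inner x x)).

Lemma gnorm_ge0 x : 0 <= gnorm x. Proof. exact: sqrtr_ge0. Qed.

Lemma ler_fsq x z : fsq x z <= gnorm x ^+ 2.
Proof.
rewrite sqr_sqrtr ?cnorm_ge0// -lecR -fsqE.
apply: le_trans (ler_cnorm _ z).
by rewrite fsqE ger0_norm// ler0c fsq_ge0.
Qed.

Lemma gnorm_le x (e : R) : 0 <= e -> (forall z, fsq x z <= e ^+ 2) ->
  gnorm x <= e.
Proof.
move=> e0 fe; rewrite -(ger0_norm e0) -sqrtr_sqr ler_sqrt ?sqr_ge0//.
apply: cnorm_le => [|z]; first exact: sqr_ge0.
by rewrite fsqE ger0_norm ?ler0c ?fsq_ge0// lecR.
Qed.

Lemma rnorm_ge0 (c : R[i]) : 0 <= rnorm c.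
Proof. by rewrite -ler0c complex_normE. Qed.

Lemma ler_gnorm x w : rnorm ((x : C) w) <= gnorm x.
Proof.
rewrite -(@ler_pXn2r _ 2)// ?nnegrE ?rnorm_ge0 ?gnorm_ge0//.
apply: le_trans (ler_fsq x (h w)).
have wf : w \in fibre (h w).
  by rewrite in_fset_set ?inE//; exact: local_homeo_finite_fibre.
rewrite /fsq (big_rem w)//= lerDl.
by apply: sumr_ge0 => v _; exact: sqr_ge0.
Qed.

Let gnormD x y : (gnorm (x + y))%:C <= (gnorm x)%:C + (gnorm y)%:C.
Proof.
have eq0 u : gnorm u <= 0 -> u = 0.
  move=> u0; apply/cfunP => w; apply/eqP; rewrite -normr_le0 -complex_normE.
  by rewrite lecR (le_trans (ler_gnorm u w)).
rewrite -rmorphD/= lecR.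
have [/eq0->|x0] := leP (gnorm x) 0; first by rewrite add0r lerDr gnorm_ge0.
have [/eq0->|y0] := leP (gnorm y) 0; first by rewrite addr0 lerDl gnorm_ge0.
apply: gnorm_le => [|z]; first by rewrite addr_ge0// ltW.
have peter_paul (a b : R) : (a + b) ^+ 2 <=
    (1 + gnorm y / gnorm x) * a ^+ 2 + (1 + gnorm x / gnorm y) * b ^+ 2.
  rewrite -subr_ge0.
  have -> : (1 + gnorm y / gnorm x) * a ^+ 2 + (1 + gnorm x / gnorm y) * b ^+ 2
      - (a + b) ^+ 2 = (gnorm y * a - gnorm x * b) ^+ 2 / (gnorm x * gnorm y).
    by field; rewrite !gt_eqF.
  by rewrite divr_ge0 ?sqr_ge0// mulr_ge0 ?ltW.
apply: (@le_trans _ _ ((1 + gnorm y / gnorm x) * fsq x z +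
                       (1 + gnorm x / gnorm y) * fsq y z)).
  rewrite /fsq !mulr_sumr -big_split/=; apply: ler_sum => w _.
  apply: le_trans (peter_paul _ _).
  rewrite ler_pXn2r ?nnegrE ?rnorm_ge0 ?addr_ge0 ?rnorm_ge0//.
  by rewrite -lecR rmorphD/= !complex_normE ler_normD.
have -> : (gnorm x + gnorm y) ^+ 2 = (1 + gnorm y / gnorm x) * gnorm x ^+ 2 +
                       (1 + gnorm x / gnorm y) * gnorm y ^+ 2.
  by field; rewrite !gt_eqF.
by apply: lerD; apply: ler_wpM2l; rewrite ?ler_fsq// addr_ge0// divr_ge0// ltW.
Qed.

Let gnormZ k x : (gnorm (k *: x))%:C = `|k| * (gnorm x)%:C.
Proof.
have H c u : gnorm (c *: u) <= rnorm c * gnorm u.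
  apply: gnorm_le => [|z]; first by rewrite mulr_ge0 ?rnorm_ge0 ?gnorm_ge0.
  have -> : fsq (c *: u) z = rnorm c ^+ 2 * fsq u z.
    rewrite /fsq mulr_sumr; apply: eq_bigr => w _; rewrite -exprMn.
    congr (_ ^+ 2); apply: complexI; rewrite rmorphM/= !complex_normE.
    exact: normrM.
  by rewrite exprMn ler_wpM2l ?sqr_ge0// ler_fsq.
rewrite -complex_normE -rmorphM/=; congr (_%:C).
apply/eqP; rewrite eq_le H/=.
have [->|k0] := eqVneq k 0.
  by rewrite {1}/rnorm normr0 mul0r gnorm_ge0.
have := H k^-1 (k *: x); rewrite scalerA mulVf// scale1r.
have rk : 0 < rnorm k by rewrite -ltcR complex_normE; rewrite normr_gt0.
have -> : rnorm k^-1 = (rnorm k)^-1.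
  by apply: complexI; rewrite complex_normE fmorphV/= complex_normE normfV.
by rewrite mulrC ler_pdivlMr// mulrC.
Qed.

Let gnorm0_eq0 x : (gnorm x)%:C = 0 -> x = 0.
Proof.
move=> [x0]; apply/cfunP => w; apply/eqP; rewrite -normr_le0 -complex_normE.
by rewrite lecR -[leRHS]x0 ler_gnorm.
Qed.

HB.instance Definition _ := @Lmodule_isNormed.Build R[i] X
  (fun x => (gnorm x)%:C) gnormD gnormZ gnorm0_eq0.

Lemma gc_normE x : `|x| = (gnorm x)%:C :> R[i]. Proof. by []. Qed.

Lemma ler_cfun_gnorm x : `|x : C| <= `|x|.
Proof.
apply: cfun_norm_le => [|w]; first exact: normr_ge0.
by rewrite -complex_normE gc_normE lecR ler_gnorm.
Qed.

Lemma graph_corr_complete (F : set_system X) :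
  ProperFilter F -> cauchy F -> cvg F.
Proof.
move=> FF /cauchy_ballP Fc.
have FC : cauchy (F : set_system C).
  apply/cauchy_ballP => e e0.
  have [[A B] [/= FA FB] AB] := Fc e e0.
  exists (A, B) => //= -[x y] /= xy; have := AB (x, y) xy.
  rewrite -!ball_normE/=; apply: le_lt_trans.
  exact: (ler_cfun_gnorm (x - y)).
have /cvg_ex[l Fl] := cfun_complete FF FC.
apply/cvg_ex; exists (l : X); apply/cvgrPdist_le => e e0.
have [[A B] [/= FA FB] AB] := Fc e e0.
apply: filterS FB => y By.
have [{}e0 eE] := gt0_complexE e0.
rewrite gc_normE eE lecR; apply: gnorm_le => [|z]; first exact: ltW.
have lim_fsq : fsq (x - y) z @[x --> F] --> fsq ((l : X) - y) z.
  rewrite /fsq; apply: cvg_big => [|w _]; first exact: add_continuous.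
  have xw : (fun x : X => (x : C) w) @ F --> (l : C) w.
    apply/cvgrPdist_lt => d d0.
    move/cvgrPdist_lt: Fl => /(_ d d0); apply: filterS => x.
    by apply: le_lt_trans; exact: (ler_cfun_norm (l - (x : C))).
  have xyw : (fun x : X => (x : C) w - (y : C) w) @ F --> (l : C) w - (y : C) w.
    exact: (cvgB xw (cvg_cst _)).
  have nxyw := cvg_Re FF (cvg_norm xyw).
  exact: (cvgM (nxyw _) (nxyw _)).
rewrite -(cvg_lim _ lim_fsq)//; apply: limr_le; first by apply/cvg_ex; eexists; exact: lim_fsq.
apply: filterS FA => x Ax; apply: le_trans (ler_fsq _ z) _.
rewrite ler_pXn2r ?nnegrE ?gnorm_ge0// ?ltW// -ltcR -eE -gc_normE.
by have := AB (x, y) (conj Ax By); rewrite -ball_normE.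
Qed.

HB.instance Definition _ := Uniform_isComplete.Build X graph_corr_complete.

Let gc_lactDl (a b : C) x : gc_lact (a + b) x = gc_lact a x + gc_lact b x.
Proof. exact: cmulDl. Qed.
Let gc_lactDr (a : C) x y : gc_lact a (x + y) = gc_lact a x + gc_lact a y.
Proof. exact: cmulDr. Qed.
Let gc_lactZl k (a : C) x : gc_lact (k *: a) x = k *: gc_lact a x.
Proof. exact: cmulZl. Qed.
Let gc_lactZr k (a : C) x : gc_lact a (k *: x) = k *: gc_lact a x.
Proof. exact: cmulZr. Qed.
Let gc_lactM (a b : C) x : gc_lact (a ** b) x = gc_lact a (gc_lact b x).
Proof. exact/esym/cmulA. Qed.
Let gc_ractDl x y (a : C) : gc_ract (x + y) a = gc_ract x a + gc_ract y a.
Proof. by apply/cfunP => z; exact: mulrDl. Qed.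
Let gc_ractDr x (a b : C) : gc_ract x (a + b) = gc_ract x a + gc_ract x b.
Proof. by apply/cfunP => z; exact: mulrDr. Qed.
Let gc_ractZl k x (a : C) : gc_ract (k *: x) a = k *: gc_ract x a.
Proof. by apply/cfunP => z; apply/esym; exact: mulrA. Qed.
Let gc_ractZr k x (a : C) : gc_ract x (k *: a) = k *: gc_ract x a.
Proof. by apply/cfunP => z; exact: mulrCA. Qed.
Let gc_ractM x (a b : C) : gc_ract x (a ** b) = gc_ract (gc_ract x a) b.
Proof. by apply/cfunP => z; exact: mulrA. Qed.
Let gc_lactA (a : C) x (b : C) :
  gc_ract (gc_lact a x) b = gc_lact a (gc_ract x b).
Proof. by apply/cfunP => z; apply/esym; exact: mulrA. Qed.

Let gc_innerDr x y (u : X) : gc_inner x (y + u) = gc_inner x y + gc_inner x u.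
Proof.
apply/cfunP => z; rewrite cfunDE /= /mkcfun /mkcts !fibre_sumE -big_split/=.
by apply: eq_bigr => w _; exact: mulrDr.
Qed.
Let gc_innerZr k x y : gc_inner x (k *: y) = k *: gc_inner x y.
Proof.
apply/cfunP => z; rewrite cfunZE /= /mkcfun /mkcts !fibre_sumE mulr_sumr.
by apply: eq_bigr => w _; exact: mulrCA.
Qed.
Let gc_inner_ract x y (a : C) : gc_inner x (gc_ract y a) = gc_inner x y ** a.
Proof.
apply/cfunP => z; have -> : (gc_inner x y ** a) z = gc_inner x y z * a z by [].
rewrite /= /mkcfun /mkcts (fibre_sumE (fun w => (x w)^* * y w)) mulr_suml -fibre_sumE.
by apply: fibre_sum_eq => w <-; exact: mulrA.
Qed.
Let gc_inner_star x y : cstar (gc_inner x y) = gc_inner y x.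
Proof.
apply/cfunP => z; have -> : (cstar (gc_inner x y) : C) z = (gc_inner x y z)^* by [].
rewrite /= /mkcfun /mkcts !fibre_sumE rmorph_sum/=.
by apply: eq_bigr => w _; rewrite rmorphM/= conjcK mulrC.
Qed.
Let gc_inner_ge0 x : exists b : C, gc_inner x x = cstar b ** b.
Proof.
have cb : continuous (fun z => (Num.sqrt (fsq x z))%:C).
  move=> z; apply: cvg_complex; last exact: cvg_cst.
  apply: (@cvg_comp _ _ _ (fsq x) Num.sqrt); last exact: sqrt_continuous.
  have -> : fsq x = (fun z => complex.Re (gc_inner x x z)).
    by apply/funext => t; rewrite fsqE.
  by apply: cvg_Re; exact: cfun_cts.
exists (mkcfun cZ cb); apply/cfunP => z; rewrite fsqE.
have -> : (cstar (mkcfun cZ cb) ** mkcfun cZ cb) z =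
  ((Num.sqrt (fsq x z))%:C)^* * (Num.sqrt (fsq x z))%:C by [].
rewrite mulrC -sqr_normc ger0_norm ?ler0c ?sqrtr_ge0//.
by rewrite -rmorphXn/= sqr_sqrtr// fsq_ge0.
Qed.
Let gc_norm_inner x : `|gc_inner x x| = `|x| ^+ 2.
Proof. by rewrite gc_normE -rmorphXn/= sqr_sqrtr ?cnorm_ge0. Qed.
Let gc_inner_lact (a : C) x y :
  gc_inner (gc_lact a x) y = gc_inner x (gc_lact (cstar a) y).
Proof.
apply/cfunP => z; apply: fibre_sum_eq => w _.
have -> : (gc_lact a x : C) w = a w * x w by [].
have -> : (gc_lact (cstar a) y : C) w = (a w)^* * y w by [].
by rewrite rmorphM/= -mulrA mulrCA.
Qed.

HB.instance Definition _ := isHilbertBimodule.Build R C X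
  gc_lactDl gc_lactDr gc_lactZl gc_lactZr gc_lactM
  gc_ractDl gc_ractDr gc_ractZl gc_ractZr gc_ractM gc_lactA
  gc_innerDr gc_innerZr gc_inner_ract gc_inner_star gc_inner_ge0
  gc_norm_inner gc_inner_lact.
End GraphCorrespondence.

Section HilbertModuleOperators.
Variables (R : realType) (A : cstarAlgType R) (X : hilbertBimodType A).
Implicit Types (S T : X -> X) (x y z : X).

Definition adjoint_of S S' := forall x y, hinner (S x) y = hinner x (S' y).

Definition adjointable S := exists S', adjoint_of S S'.

Definition Theta x y : X -> X := fun z => hract x (hinner y z).

Definition in_span_Theta S := exists s : seq (R[i] * (X * X)),
  forall z, S z = \sum_(p <- s) p.1 *: Theta p.2.1 p.2.2 z.

(* K(X): the closure of the span in the operator norm of L(X) *)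
Definition compact_op S := adjointable S /\
  forall e : R[i], 0 < e -> exists2 F, in_span_Theta F &
    forall z, `|S z - F z| <= e * `|z|.

End HilbertModuleOperators.

Section CStarNotions.
Variable R : realType.
Implicit Types A B : cstarAlgType R.

Definition star_hom A B (f : A -> B) :=
  [/\ linear f, {morph f : a b / a ** b} & {morph f : a / cstar a}].

Definition cstar_subalg A (S : set A) :=
  [/\ closed S, S 0,
      forall (k : R[i]) a b, S a -> S b -> S (k *: a + b),
      forall a b, S a -> S b -> S (a ** b) &
      forall a, S a -> S (cstar a)].

Definition closed_ideal A (J : set A) :=
  [/\ closed J, J 0,
      forall (k : R[i]) a b, J a -> J b -> J (k *: a + b) &
      forall a b, J b -> J (a ** b) /\ J (b ** a)].

Definition circle : set R[i] := [set z | `|z| = 1].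

Definition circle_action B (g : R[i] -> B -> B) :=
  [/\ forall z, circle z -> star_hom (g z),
      g 1 =1 id,
      forall z w, circle z -> circle w -> g (z * w) =1 g z \o g w &
      forall b, {within circle, continuous (g ^~ b)}].

Definition state B (phi : B -> R[i]) :=
  [/\ scalar phi,
      forall b, 0 <= phi (cstar b ** b),
      forall b, `|phi b| <= `|b| &
      forall e : R[i], 0 < e -> exists2 b, `|b| <= 1 & 1 - e < `|phi b|].

Definition entire B (F : R[i] -> B) := forall z, derivable F z 1.

Definition analytic_extension B (alpha : R -> B -> B) (a : B) (F : R[i] -> B) :=
  entire F /\ forall t : R, F t%:C = alpha t a.

Definition analytic B (alpha : R -> B -> B) (a : B) :=
  exists F, analytic_extension alpha a F.

(* The entire extension F of t |-> alpha t a is unique, so F (i * beta) is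
   alpha_{i beta}(a). *)
Definition kms_state B (alpha : R -> B -> B) (beta : R) (phi : B -> R[i]) :=
  state phi /\
  forall a b (F : R[i] -> B), analytic_extension alpha a F -> analytic alpha b ->
    phi (a ** b) = phi (b ** F (0 +i* beta)).

End CStarNotions.

Section CuntzPimsner.
Variables (R : realType) (A : cstarAlgType R) (X : hilbertBimodType A).

Definition representation (C : cstarAlgType R) (psi : X -> C) (pi : A -> C) :=
  [/\ linear psi, star_hom pi,
      forall a x b, psi (hract (hlact a x) b) = pi a ** psi x ** pi b &
      forall x y, pi (hinner x y) = cstar (psi x) ** psi y].

(* T(X) and O(X) are determined up to isomorphism by these properties. *)
Record toeplitz_algebra := ToeplitzAlgebra {
  toep_alg :> cstarAlgType R;
  toep_psi : X -> toep_alg;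
  toep_pi : A -> toep_alg;
  toep_rep : representation toep_psi toep_pi;
  toep_universal : forall (C : cstarAlgType R) (psi : X -> C) (pi : A -> C),
    representation psi pi -> exists rho : toep_alg -> C,
      [/\ star_hom rho, rho \o toep_psi =1 psi & rho \o toep_pi =1 pi];
  toep_generated :
    smallest (@cstar_subalg R toep_alg) (range toep_psi `|` range toep_pi)
      = [set: toep_alg]
}.

(* kappa is (psi, pi)^(1); its values outside K(X) are irrelevant *)
Definition compact_hom (T : toeplitz_algebra) (kappa : (X -> X) -> T) :=
  [/\ forall (k : R[i]) S S', compact_op S -> compact_op S' ->
        kappa (fun z => k *: S z + S' z) = k *: kappa S + kappa S',
      forall S S', compact_op S -> compact_op S' ->
        kappa (S \o S') = kappa S ** kappa S',
      forall S S', compact_op S -> compact_op S' -> adjoint_of S S' ->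
        kappa S' = cstar (kappa S) &
      forall x y, kappa (Theta x y) = toep_psi T x ** cstar (toep_psi T y)].

Record cuntz_pimsner (T : toeplitz_algebra) := CuntzPimsner {
  cp_alg :> cstarAlgType R;
  cp_quot : T -> cp_alg;
  cp_kappa : (X -> X) -> T;
  cp_kappaP : compact_hom cp_kappa;
  cp_quot_hom : star_hom cp_quot;
  cp_quot_surj : range cp_quot = [set: cp_alg];
  cp_quot_ker : cp_quot @^-1` [set 0] =
    smallest (@closed_ideal R T)
      [set toep_pi T a - cp_kappa (hlact a) |
         a in [set a | compact_op (hlact a : X -> X)]]
}.

(* gamma is the action induced on O(X) by the gauge action g of T(X); values at
   scalars off the unit circle are irrelevant *)
Definition gauge_action (T : toeplitz_algebra) (O : cuntz_pimsner T)
    (gamma : R[i] -> O -> O) :=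
  circle_action gamma /\
  exists2 g : R[i] -> T -> T,
    [/\ circle_action g,
        forall z x, circle z -> g z (toep_psi T x) = z *: toep_psi T x &
        forall z a, circle z -> g z (toep_pi T a) = toep_pi T a] &
    forall z t, circle z -> gamma z (cp_quot O t) = cp_quot O (g z t).

End CuntzPimsner.

Definition cis (R : realType) (t : R) : R[i] := cos t +i* sin t.

Section FibreGrowth.
Variables (Z : topologicalType) (h : Z -> Z).

Definition fibre_card n z : nat := #|` fset_set (iter n h @^-1` [set z])|%fset.

(* For a local homeomorphism of a compact Hausdorff space the fibres of the
   iterates are finite of bounded cardinality, so the maximum exists as soon as
   Z is nonempty. *)
Definition max_fibre_card n : nat := xget 0%N
  [set m | (exists z, fibre_card n z = m) /\
           forall z, (fibre_card n z <= m)%N].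

Definition beta_c (R : realType) : \bar R :=
  limn_esup (fun n => (n%:R^-1 * ln (max_fibre_card n)%:R)%:E).
End FibreGrowth.

(* Main.v *)
(* Let pi and psi be the canonical maps of C(Z) and X(E) into O(X(E)). A finite
   family (x_i, y_i) with sum_i Theta_{x_i, y_i} = id shows that the unit acts by
   compact operators, so pi(1) = sum_i psi(x_i) psi(y_i)^* in O(X(E)). The gauge
   flow multiplies psi(x) by e^{it}, so the KMS condition moves psi(a x_i) around
   psi(y_i)^* at the cost of a factor e^{-beta}:
     phi(pi(a)) = e^{-beta} phi(pi(L a)),  (L a)(z) = sum_{h(w) = z} a(w).
   Iterating at a = 1 gives e^{n beta} phi(pi(1)) = phi(pi(L^n 1)), where
   L^n 1 (z) = |h^{-n}(z)|. Since M 1 - L^n 1 is of the form b^* b for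
   M = max_z |h^{-n}(z)|, positivity of phi bounds the right-hand side by
   M phi(pi(1)), and phi(pi(1)) > 0 because pi(1) is a unit of O(X(E)).
   Hence e^{n beta} <= M for all n. *)
Require Import Defs.
From HB Require Import structures.
From mathcomp Require Import all_boot all_order all_algebra.
From mathcomp Require Import complex finmap ring lra.
From mathcomp Require Import all_classical all_reals.
From mathcomp Require Import topology normedtype ereal sequences derive realfun exp trigo.
Import Order.TTheory GRing.Theory Num.Theory.
Import numFieldNormedType.Exports.
Set Implicit Arguments. Unset Strict Implicit. Unset Printing Implicit Defensive.
Local Open Scope classical_set_scope.
Local Open Scope ring_scope.
Local Open Scope complex_scope.

(** * Linear maps, C*-algebras and states *)

Lemma linear_for_sum (K : pzRingType) (U : lmodType K) (V : zmodType)
    (a : GRing.Scale.law K V) (f : U -> V) I (r : seq I) (F : I -> U) :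
  linear_for a f -> f (\sum_(i <- r) F i) = \sum_(i <- r) f (F i).
Proof.
move=> fl; pose g : {linear U -> V | a} := HB.pack f (GRing.isLinear.Build K U V a f fl).
exact: (raddf_sum g).
Qed.

Section CStarAlgebraLemmas.
Variable R : realType.
Implicit Types B : cstarAlgType R.

Lemma cmul0r B (a : B) : 0 ** a = 0.
Proof. by rewrite -[in LHS](scale0r (0 : B)) cmulZl scale0r. Qed.

Lemma cmulr0 B (a : B) : a ** 0 = 0.
Proof. by rewrite -[in LHS](scale0r (0 : B)) cmulZr scale0r. Qed.

Lemma cstar0 B : cstar (0 : B) = 0.
Proof. by rewrite -[in LHS](scale0r (0 : B)) cstarZ rmorph0 scale0r. Qed.

Lemma cstarZ_conjc B (k : R[i]) (a : B) : cstar (k *: a) = conjc k *: cstar a.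
Proof. exact: cstarZ. Qed.

Lemma cmul_sumr B I (s : seq I) (a : B) (F : I -> B) :
  a ** (\sum_(i <- s) F i) = \sum_(i <- s) a ** F i.
Proof. by elim: s => [|i s IH]; rewrite ?big_nil ?cmulr0// !big_cons cmulDr IH. Qed.

Lemma cmulBr B (a b c : B) : a ** (b - c) = a ** b - a ** c.
Proof. by rewrite cmulDr -scaleN1r cmulZr scaleN1r. Qed.

Lemma cmulBl B (a b c : B) : (a - b) ** c = a ** c - b ** c.
Proof. by rewrite cmulDl -scaleN1r cmulZl scaleN1r. Qed.

Lemma cmul_continuous B (a : B) : continuous (cmul a) /\ continuous (cmul^~ a).
Proof.
have n1 : 0 < `|a| + 1 by rewrite ltr_wpDl.
split=> b; apply/cvgrPdist_lt => e e0;
  have /cvgrPdist_lt/(_ _ (divr_gt0 e0 n1)) H := @cvg_id _ (nbhs b);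
  apply: filterS H => c /=; rewrite ltr_pdivlMr// => H.
  rewrite -cmulBr (le_lt_trans (ler_norm_cmul _ _))// (le_lt_trans _ H)//.
  by rewrite mulrC ler_wpM2l// lerDl.
rewrite -cmulBl (le_lt_trans (ler_norm_cmul _ _))// (le_lt_trans _ H)//.
by rewrite ler_wpM2l// lerDl.
Qed.

(** Allows the unit property to be checked on generators only. Closedness comes from continuity of
    multiplication; for closure under [cstar], self-adjointness of u exchanges the two
    conditions. *)
Lemma two_sided_identity_subalg B (u : B) : cstar u = u ->
  cstar_subalg [set b | u ** b = b /\ b ** u = b].
Proof.
move=> su; split=> //=.
- have cl (f : B -> B) : continuous f -> closed [set b | f b = b].
    move=> cf; have -> : [set b | f b = b] = (fun b => f b - b) @^-1` [set 0].
      by apply/seteqP; split=> b /= => [->|/eqP]; rewrite ?subrr// subr_eq0 => /eqP.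
    apply: preimage_closed.
      by move=> b _; apply: cvgB; [exact: cf|exact: cvg_id].
    exact: accessible_closed_set1 (hausdorff_accessible (@norm_hausdorff _ B)) 0.
  have [c1 c2] := cmul_continuous u.
  have -> : [set b | u ** b = b /\ b ** u = b] =
    [set b | u ** b = b] `&` [set b | b ** u = b] by [].
  by apply: closedI; exact: cl.
- by rewrite cmulr0 cmul0r.
- by move=> k a b [a1 a2] [b1 b2]; rewrite cmulDr cmulDl cmulZr cmulZl a1 a2 b1 b2.
- by move=> a b [a1 a2] [b1 b2]; rewrite cmulA a1 -cmulA b2.
- by move=> a [a1 a2]; rewrite -su -!cstarM a1 a2.
Qed.

(** As p is real, s = 1 forces x to be real. A real quadratic in s without constant term changes
    sign at 0 unless its linear coefficient vanishes. *)
Lemma real_quadratic_ge0_eq0 (x p : R[i]) :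
  (forall s : R, 0 <= s%:C * x + (s ^+ 2)%:C * p) -> 0 <= p -> x = 0.
Proof.
case: x p => [a b] [p q] H; rewrite lecE/= => /andP[/eqP q0 p0].
have := H 1; rewrite lecE/= => /andP[/eqP b0 _].
(* At this s the real part equals -(a / (p + 1))^2; unlike p, the denominator p + 1 is never
   zero. *)
have := H (- a / (p + 1)); rewrite lecE/= => /andP[_ a0].
have p1 : 0 < p + 1 by lra.
have : 0 <= - (a / (p + 1)) ^+ 2.
  by apply: le_trans a0 _; rewrite le_eqVlt; apply/orP; left; apply/eqP; field; rewrite gt_eqF.
rewrite oppr_ge0 => a2; have /eqP := le_anti (introT andP (conj a2 (sqr_ge0 _))).
rewrite sqrf_eq0 mulf_eq0 invr_eq0 (gt_eqF p1) orbF => /eqP ->.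
by move: b0; rewrite q0 => b0; apply/eqP; rewrite eq_complex/= eqxx; apply/eqP; lra.
Qed.

Lemma state_unit_gt0 B (u : B) (phi : B -> R[i]) : state phi ->
  cstar u = u -> (forall b, u ** b = b /\ b ** u = b) -> 0 < phi u.
Proof.
move=> [phil phi0 _ phi1] su u1.
have [uu _] := u1 u.
have pu : 0 <= phi u by rewrite -uu -{1}su.
rewrite lt_neqAle pu andbT; apply/negP => /eqP/esym u0.
have phiZ k a : phi (k *: a) = k * phi a := scalable_linear phil k a.
have phiD : {morph phi : a b / a + b} := (GRing.semilinear_linear phil).2.
(* The argument of Cauchy-Schwarz: phi u = 0 would force phi = 0. *)
have f0 b : phi b + phi (cstar b) = 0.
  apply: (@real_quadratic_ge0_eq0 _ (phi (cstar b ** b))) => // s.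
  have := phi0 (u + s%:C *: b).
  rewrite cstarD cstarZ_conjc su cmulDl !cmulDr !cmulZl !cmulZr uu (u1 b).1 (u1 (cstar b)).2.
  rewrite !phiD !phiZ u0 add0r conjc_real.
  by rewrite addrA -mulrDr mulrA -rmorphM -expr2.
have ci : conjc 'i = - 'i :> R[i] by apply/eqP; rewrite eq_complex/= oppr0 !eqxx.
(* Replacing b by i b turns the vanishing sum of phi(b) and phi(b^* ) into a vanishing
   difference. *)
have phib0 b : phi b = 0.
  have /eqP := f0 ('i *: b); rewrite cstarZ_conjc !phiZ ci mulNr -mulrBr mulf_eq0.
  have -> : ('i == 0 :> R[i]) = false by apply/negbTE; rewrite eq_complex/= oner_eq0 andbF.
  rewrite orFb subr_eq0 => /eqP E; have := f0 b; rewrite -E -mulr2n => /eqP.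
  by rewrite mulrn_eq0/= => /eqP.
(* A state has norm one, so some b satisfies |phi b| > 1/2, which excludes phi = 0. *)
have [|b _] := phi1 (1 / 2); first by rewrite divr_gt0.
by rewrite phib0 normr0 subr_lt0 => /lt_geF; rewrite ler_pdivrMr// mul1r ler1n.
Qed.

End CStarAlgebraLemmas.

(** * The function e^{iz} and its derivative *)

Section ComplexExponential.
Variable R : realType.

(* e^{iz} *)
Definition cexpi (z : R[i]) : R[i] :=
  (expR (- complex.Im z))%:C * cis (complex.Re z).

Lemma norm_cis (t : R) : `|cis t| = 1.
Proof. by rewrite /cis normc_def cos2Dsin2 sqrtr1. Qed.

Lemma conj_cis (t : R) : (cis t)^* = cis (- t).
Proof. by rewrite /cis cosN sinN. Qed.

Lemma cexpi_real (t : R) : cexpi t%:C = cis t.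
Proof. by rewrite /cexpi /= oppr0 expR0 mul1r. Qed.

Lemma cexpi_imaginary (t : R) : cexpi (0 +i* t) = (expR (- t))%:C.
Proof.
rewrite /cexpi /= /cis cos0 sin0; apply/eqP; rewrite eq_complex /=.
by apply/andP; split; apply/eqP; ring.
Qed.

Lemma cexpiD z w : cexpi (z + w) = cexpi z * cexpi w.
Proof.
case: z w => [a b] [c d]; rewrite /cexpi /cis /= opprD expRD cosD sinD.
by apply/eqP; rewrite eq_complex /=; apply/andP; split; apply/eqP; ring.
Qed.

Lemma is_derive0_near (f : R -> R) (d e : R) : is_derive (0 : R) 1 f d -> 0 < e ->
  \forall x \near (0 : R), `|f x - f 0 - d * x| <= e * `|x|.
Proof.
move=> [fd dE] e0.
have : h^-1 *: (f (h *: 1 + 0) - f 0) @[h --> (0 : R)^'] --> d by rewrite -dE; exact: fd.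
move/cvgrPdist_le => /(_ e e0); rewrite near_withinE; apply: filterS => x.
have [->|x0 /(_ isT)] := eqVneq x 0; first by rewrite mulr0 subrr subr0 normr0 mulr0.
rewrite /= -[_ *: 1]/(x * 1) mulr1 addr0 => H.
have -> : f x - f 0 - d * x = - ((d - x^-1 *: (f x - f 0)) * x).
  by rewrite -[_ *: _]/(x^-1 * _); field.
by rewrite normrN normrM ler_wpM2r.
Qed.

(** The remainder is estimated in real and imaginary parts from the expansions of [expR], [cos] and
    [sin] at 0; the addition law [cexpiD] later carries this to every point. *)
Lemma cexpi_near0 (e : R) : 0 < e ->
  exists2 d : R, 0 < d & forall z, rnorm z < d ->
    rnorm (cexpi z - 1 - 'i * z) <= e * rnorm z.
Proof.
(* Real and imaginary parts contribute 3 e' |z| each, whence e / 6; the bound e' <= 1 keeps the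
   factor e^{-y} at most 2. *)
move=> e0; pose e' := Num.min (e / 6) 1.
have e'0 : 0 < e' by rewrite lt_min ltr01 divr_gt0.
have e'e : 6 * e' <= e by rewrite mulrC -ler_pdivlMr// ge_min lexx.
have e'1 : e' <= 1 by rewrite ge_min lexx orbT.
have De : is_derive (0 : R) 1 expR 1.
  by rewrite -[X in is_derive _ _ _ X]expR0; exact: is_derive_expR.
have Dc : is_derive (0 : R) 1 (@cos R) 0.
  by rewrite -[X in is_derive _ _ _ X]oppr0 -[X in - X](@sin0 R); exact: is_derive_cos.
have Ds : is_derive (0 : R) 1 (@sin R) 1.
  by rewrite -[X in is_derive _ _ _ X]cos0; exact: is_derive_sin.
have [d /= d0 dP] : \forall x \near (0 : R), [/\ `|expR x - 1 - x| <= e' * `|x|,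
    `|cos x - 1| <= e' * `|x|, `|sin x - x| <= e' * `|x| & `|expR x - 1| <= e'].
  have H1 : \forall x \near (0 : R), `|expR x - 1 - x| <= e' * `|x|.
    by apply: filterS (is_derive0_near De e'0) => x; rewrite expR0 mul1r.
  have H2 : \forall x \near (0 : R), `|cos x - 1| <= e' * `|x|.
    by apply: filterS (is_derive0_near Dc e'0) => x; rewrite cos0 mul0r subr0.
  have H3 : \forall x \near (0 : R), `|sin x - x| <= e' * `|x|.
    by apply: filterS (is_derive0_near Ds e'0) => x; rewrite sin0 mul1r subr0.
  have H4 : \forall x \near (0 : R), `|expR x - 1| <= e'.
    have /cvgrPdist_le/(_ _ e'0) := @continuous_expR R 0.
    by apply: filterS => x; rewrite expR0 distrC.
  by near=> x; split; near: x.
exists d => // -[x y] zd.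
have nx := ler_normRe (x +i* y); have ny := ler_normIm (x +i* y); rewrite /= in nx ny.
set r := rnorm _ in zd nx ny *.
have : ball (0 : R) d x by rewrite /ball /= sub0r normrN (le_lt_trans nx).
move/dP => [_ c1 s1 _].
have : ball (0 : R) d (- y) by rewrite /ball /= sub0r opprK (le_lt_trans ny).
move/dP; rewrite normrN => -[a1 _ _ a2].
apply: le_trans (ler_Re_norm _) _; rewrite /cexpi /cis /=.
set a := expR (- y) in a1 a2 *; set c := cos x in c1 *; set s := sin x in s1 *.
have a3 : `|a| <= 2.
  by rewrite -(subrK 1 a) (le_trans (ler_normD _ _))// normr1; lra.
have r0 : 0 <= r := le_trans (normr_ge0 _) nx.
have xr : e' * `|x| <= e' * r by rewrite ler_wpM2l// ltW.
have yr : e' * `|y| <= e' * r by rewrite ler_wpM2l// ltW.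
apply: (@le_trans _ _ (3 * (e' * r) + 3 * (e' * r))); last first.
  by rewrite -mulrDl -[3 + 3]/(_ : R) mulrA ler_wpM2r//; lra.
apply: lerD.
  have -> : a * c - 0 * s - 1 - (0 * x - 1 * y) = (a - 1 - - y) + a * (c - 1) by ring.
  rewrite (le_trans (ler_normD _ _))// normrM.
  have : `|a| * `|c - 1| <= 2 * (e' * r) by apply: ler_pM => //; exact: le_trans xr.
  by lra.
have -> : a * s + 0 * c - 0 - (0 * y + 1 * x) = (a - 1) * x + a * (s - x) by ring.
rewrite (le_trans (ler_normD _ _))// !normrM.
have : `|a| * `|s - x| <= 2 * (e' * r) by apply: ler_pM => //; exact: le_trans xr.
have : `|a - 1| * `|x| <= e' * r by apply: ler_pM.
by lra.
Unshelve. all: by end_near. Qed.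

(** The case s = 1 serves psi(x) and s = -1 its adjoint. The addition law reduces the difference
    quotient at z to the one at 0, and |s k| = |k|. *)
Lemma entire_cexpi (B : cstarAlgType R) (s : R[i]) (b : B) : circle s ->
  entire (fun z => cexpi (s * z) *: b).
Proof.
move=> s1 z; rewrite /derivable; have [E EE] : exists E, E = cexpi (s * z) by eexists.
apply/cvg_ex; exists ((E * ('i * s)) *: b).
apply/cvgrPdist_le => e e0.
have [{}e0 eE] := gt0_complexE e0.
(* The summand 1 keeps M positive when b = 0. *)
set nb := complex.Re `|b|; pose M := rnorm E * nb + 1.
have M0 : 0 < M.
  rewrite ltr_wpDl// mulr_ge0 ?rnorm_ge0//.
  by have := normr_ge0 b; rewrite lecE => /andP[].
have [d d0 dP] := cexpi_near0 (divr_gt0 e0 M0).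
rewrite near_withinE; exists d%:C; first by rewrite /= ltcR.
move=> k /=; rewrite sub0r normrN -complex_normE ltcR => kd k0.
have sk : rnorm (s * k) = rnorm k.
  by apply: complexI; rewrite !complex_normE normrM s1 mul1r.
have := dP (s * k); rewrite sk => /(_ kd) H.
have -> : (E * ('i * s)) *: b -
    k^-1 *: (cexpi (s * (k *: 1 + z)) *: b - cexpi (s * z) *: b) =
    (- (k^-1 * E * (cexpi (s * k) - 1 - 'i * (s * k)))) *: b.
  rewrite -[k *: 1]/(k * 1) mulr1 mulrDr cexpiD -EE -scalerBl scalerA -scalerBl.
  by congr (_ *: b); field.
set D := _ - 1 - _ in H *.
have bE : `|b| = nb%:C by rewrite RRe_real// ger0_real.
have k0' : 0 < rnorm k by rewrite -ltcR complex_normE normr_gt0.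
rewrite normrZ normrN !normrM normfV -!complex_normE bE eE -fmorphV -!rmorphM lecR.
have nb0 : 0 <= nb by rewrite -ler0c -bE.
have -> : (rnorm k)^-1 * rnorm E * rnorm D * nb = (rnorm E * nb) * (rnorm D / rnorm k).
  by ring.
apply: (@le_trans _ _ (M * (complex.Re e / M))); last by rewrite mulrC divfK ?gt_eqF.
apply: ler_pM => //; first by rewrite mulr_ge0 ?rnorm_ge0.
- by rewrite divr_ge0 ?rnorm_ge0.
- by rewrite lerDl.
- by rewrite ler_pdivrMr.
Qed.
End ComplexExponential.

(** * Finite frames of a Hilbert bimodule and covariance in O(X) *)

Section Frames.
Variables (R : realType) (A : cstarAlgType R) (X : hilbertBimodType A).
Implicit Types (x y z : X) (s : seq (X * X)).

(** The two vectors of a pair may differ, unlike in a Parseval frame; this suffices to make the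
    identity of X compact. *)
Definition frame s := forall z, z = \sum_(p <- s) Theta p.1 p.2 z.

(** Neither the algebra is unital by its type nor are the actions nondegenerate, so each action
    needs its own clause. *)
Definition bimodule_unit (u : A) :=
  [/\ cstar u = u, forall a, u ** a = a /\ a ** u = a,
      forall x, hlact u x = x & forall x, hract x u = x].

Lemma hinner0r x : hinner x 0 = 0 :> A.
Proof. by rewrite -(scale0r (0 : X)) hinnerZr scale0r. Qed.

Lemma hinner_sumr I (r : seq I) (F : I -> X) x :
  hinner x (\sum_(i <- r) F i) = \sum_(i <- r) hinner x (F i).
Proof.
by elim: r => [|i r IH]; rewrite ?big_nil ?hinner0r// !big_cons hinnerDr IH.
Qed.

Lemma hinner_suml I (r : seq I) (F : I -> X) x :
  hinner (\sum_(i <- r) F i) x = \sum_(i <- r) hinner (F i) x.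
Proof.
rewrite -hinner_star hinner_sumr (big_morph _ (@cstarD _ _) (@cstar0 _ _)).
by apply: eq_bigr => i _; rewrite hinner_star.
Qed.

Lemma Theta_adjoint x y : adjoint_of (Theta x y) (Theta y x).
Proof.
move=> u v; rewrite /Theta hinner_ract -hinner_star hinner_ract cstarM hinner_star.
by rewrite !hinner_star.
Qed.

Lemma compact_Theta_sum s : compact_op (fun z => \sum_(p <- s) Theta p.1 p.2 z).
Proof.
split.
  exists (fun z => \sum_(p <- s) Theta p.2 p.1 z) => x y.
  rewrite hinner_suml hinner_sumr; apply: eq_bigr => p _; exact: Theta_adjoint.
move=> e e0; exists (fun z => \sum_(p <- s) Theta p.1 p.2 z).
  exists [seq (1, p) | p <- s] => z; rewrite big_map.
  by apply: eq_bigr => p _; rewrite scale1r.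
by move=> z; rewrite subrr normr0 mulr_ge0// ltW.
Qed.

Lemma compact_hom_Theta_sum (T : toeplitz_algebra X) (kappa : (X -> X) -> T) s :
  compact_hom kappa ->
  kappa (fun z => \sum_(p <- s) Theta p.1 p.2 z) =
  \sum_(p <- s) toep_psi T p.1 ** cstar (toep_psi T p.2).
Proof.
move=> [kl _ _ kT]; elim: s => [|[x y] s IH].
  (* Linearity of [kappa] is given in the form k S + S'; k = -1 and S = S' = 0 yield its value at
     the zero operator. *)
  rewrite big_nil; have c0 := compact_Theta_sum [::].
  have := kl (-1) _ _ c0 c0; rewrite scaleN1r addNr => <-.
  by congr kappa; apply/funext => z; rewrite big_nil scaler0 addr0.
rewrite big_cons -kT -IH -[kappa (Theta _ _)]scale1r -kl; last 2 first.
- have := compact_Theta_sum [:: (x, y)].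
  by congr compact_op; apply/funext => z; rewrite big_seq1.
- exact: compact_Theta_sum.
by congr kappa; apply/funext => z; rewrite big_cons scale1r.
Qed.

Variables (T : toeplitz_algebra X) (O : cuntz_pimsner T).
Local Notation psi := (cp_quot O \o toep_psi T).
Local Notation pi := (cp_quot O \o toep_pi T).

Lemma cp_rep : representation psi pi.
Proof.
have [psil [pil piM piS] act inn] := toep_rep T.
have [ql qM qS] := cp_quot_hom O.
split=> /=.
- by move=> k x y /=; rewrite psil ql.
- by split=> [k a b|a b|a] /=; rewrite ?pil ?ql ?piM ?qM ?piS ?qS.
- by move=> a x b; rewrite act !qM.
- by move=> x y; rewrite inn qM qS.
Qed.

(** The Cuntz-Pimsner relation enters only here, for the single element u: it acts as the identity,
    which the frame exhibits as a finite-rank operator. *)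
Lemma cp_frame_covariance s u : frame s -> bimodule_unit u ->
  pi u = \sum_(p <- s) psi p.1 ** cstar (psi p.2).
Proof.
move=> fs [_ _ u1 _]; have [ql qM qS] := cp_quot_hom O.
have hu : hlact u = (fun z => \sum_(p <- s) Theta p.1 p.2 z) :> (X -> X).
  by apply/funext => z; rewrite u1; exact: fs.
have : (cp_quot O @^-1` [set 0]) (toep_pi T u - cp_kappa O (hlact u)).
  rewrite cp_quot_ker; apply: sub_gen_smallest; exists u => //=.
  by rewrite hu; exact: compact_Theta_sum.
rewrite /= (zmod_morphism_linear ql) => /eqP; rewrite subr_eq0 => /eqP ->.
rewrite hu (compact_hom_Theta_sum _ (cp_kappaP O)).
by rewrite (linear_for_sum _ _ ql); apply: eq_bigr => p _ /=; rewrite qM qS.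
Qed.

(** The elements of T(X) for which the image of u is a two-sided identity form a C*-subalgebra
    containing the generators, hence all of T(X); the quotient map is onto. *)
Lemma cp_unit u (b : O) : bimodule_unit u -> pi u ** b = b /\ b ** pi u = b.
Proof.
move=> [su ua ul ur].
have [psil [pil piM piS] act inn] := toep_rep T.
have [ql qM qS] := cp_quot_hom O.
have : [set: O] b by [].
rewrite -(cp_quot_surj O) => -[t _ <-].
suff [t1 t2] : toep_pi T u ** t = t /\ t ** toep_pi T u = t by rewrite /= -!qM t1 t2.
have : [set: T] t by [].
rewrite -toep_generated.
apply: (smallest_sub (X := [set t | toep_pi T u ** t = t /\ t ** toep_pi T u = t])).
  by apply: two_sided_identity_subalg; rewrite -piS su.
move=> _ [[x _ <-]|[a _ <-]] /=; last by rewrite -!piM (ua a).1 (ua a).2.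
have uu : u ** u = u by have [] := ua u.
have E : toep_psi T x = toep_pi T u ** toep_psi T x ** toep_pi T u by rewrite -act ul ur.
by split; rewrite E; [rewrite !cmulA -piM uu|rewrite -!cmulA -piM uu].
Qed.

End Frames.

(** * KMS states for the gauge flow *)

Section KMS.
Variables (R : realType) (A : cstarAlgType R) (X : hilbertBimodType A).
Variables (T : toeplitz_algebra X) (O : cuntz_pimsner T).
Variables (gamma : R[i] -> O -> O) (hgamma : gauge_action gamma).
Variables (beta : R) (phi : O -> R[i]).
Hypothesis kms : kms_state (fun t : R => gamma (cis t)) beta phi.
Local Notation psi := (cp_quot O \o toep_psi T).
Local Notation pi := (cp_quot O \o toep_pi T).

(** At z = i beta this extension has the factor e^{-beta}, the source of the scaling below. *)
Lemma gauge_psi x : analytic_extension (fun t : R => gamma (cis t)) (psi x)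
  (fun z => cexpi z *: psi x).
Proof.
have [_ [g [_ gx _] gq]] := hgamma; have [ql _ _] := cp_quot_hom O.
split.
  have := @entire_cexpi _ O 1 (psi x) (normr1 _).
  by under eq_fun do rewrite mul1r.
move=> t; have c : circle (cis t) by exact: norm_cis.
by rewrite cexpi_real /= gq// gx// (scalable_linear ql).
Qed.

Lemma gauge_psi_star x : analytic (fun t : R => gamma (cis t)) (cstar (psi x)).
Proof.
have [_ E] := gauge_psi x; have [[ga _ _ _] _] := hgamma.
exists (fun z => cexpi (- 1 * z) *: cstar (psi x)); split.
  by apply: entire_cexpi; rewrite /circle /= normrN1.
move=> t; have c : circle (cis t) by exact: norm_cis.
have [_ _ gS] := ga _ c.
rewrite gS -E cstarZ_conjc cexpi_real mulN1r -rmorphN cexpi_real.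
by rewrite [conjc _]conj_cis.
Qed.

Lemma kms_scaling (s : seq (X * X)) u a : frame s -> bimodule_unit X u ->
  phi (pi a) = (expR (- beta))%:C * phi (pi (\sum_(p <- s) hinner p.2 (hlact a p.1 : X))).
Proof.
move=> fs u1; have [_ /(_ a)[_ au] _ ur] := u1.
have [psil [pil piM piS] act inn] := cp_rep O.
have [[phil _ _ _] hk] := kms.
(* Writing a as a u makes room for the frame expansion of pi(u). *)
rewrite -{1}au piM (cp_frame_covariance O fs u1) cmul_sumr.
rewrite (linear_for_sum _ _ pil) !(linear_for_sum _ _ phil) mulr_sumr.
apply: eq_bigr => -[x y] _ /=.
have -> : pi a ** (psi x ** cstar (psi y)) = psi (hlact a x) ** cstar (psi y).
  by rewrite -[hlact a x]ur act (cp_unit _ u1).2 cmulA.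
(* After the exchange, psi(y)^* stands to the left of psi(a x), and their product is pi of an inner
   product. *)
rewrite (hk _ _ _ (gauge_psi _) (gauge_psi_star y)) cexpi_imaginary cmulZr.
rewrite (scalable_linear phil).
by congr (_ * phi _); rewrite -inn.
Qed.

Lemma kms_unit_gt0 u : bimodule_unit X u -> 0 < phi (pi u).
Proof.
move=> uu; have [_ [_ _ piS] _ _] := cp_rep O.
have [st _] := kms; apply: (state_unit_gt0 st) => [|b]; last exact: cp_unit.
by rewrite -piS; case: uu => ->.
Qed.

End KMS.

(** * Pointwise calculus in C(Z) *)

Section ContinuousFunctions.
Variables (R : realType) (Z : topologicalType) (cZ : compact [set: Z]).
Local Notation C := (cfun R cZ).

Lemma continuous_realC (f : Z -> R) : continuous f -> continuous (fun z => (f z)%:C).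
Proof. by move=> cf z; apply: cvg_complex; [exact: cf|exact: cvg_cst]. Qed.

Lemma mkcfunE (f : Z -> R[i]) (cf : continuous f) z : mkcfun cZ cf z = f z.
Proof. by []. Qed.

Lemma cfun_sumE I (r : seq I) (F : I -> C) z :
  (\sum_(i <- r) F i) z = \sum_(i <- r) F i z.
Proof. by elim: r => [|i r IH]; rewrite ?big_nil// !big_cons cfunDE IH. Qed.

Lemma cfun_mulE (f g : C) z : (f ** g) z = f z * g z. Proof. by []. Qed.

Lemma cfun_starE (f : C) z : (cstar f : C) z = conjc (f z). Proof. by []. Qed.

(** Converts pointwise positivity into the form in which [state] expresses it; b is the pointwise
    square root. *)
Lemma cfun_ge0_sqr (f : C) : (forall z, 0 <= f z) -> exists b : C, f = cstar b ** b.
Proof.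
move=> f0.
have cb : continuous (fun z => Num.sqrt (complex.Re (f z))).
  move=> z; apply: (@cvg_comp _ _ _ (fun z => complex.Re (f z)) Num.sqrt).
    by apply: cvg_Re; exact: cfun_cts.
  exact: sqrt_continuous.
exists (mkcfun cZ (continuous_realC cb)); apply/cfunP => z.
rewrite cfun_mulE cfun_starE !mkcfunE conjc_real -rmorphM/= -expr2.
rewrite sqr_sqrtr; first by rewrite RRe_real// ger0_real.
by have := f0 z; rewrite lecE => /andP[].
Qed.

Lemma cfun_unit (a : C) : cfun_cst cZ 1 ** a = a /\ a ** cfun_cst cZ 1 = a.
Proof. by split; apply/cfunP => z; rewrite cfun_mulE; [exact: mul1r|exact: mulr1]. Qed.
End ContinuousFunctions.

(** * A frame and the transfer operator of the graph correspondence *)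

Section GraphFrame.
Variables (R : realType) (Z : topologicalType) (Z0 : [set: Z] !=set0).
Variables (cZ : compact [set: Z]) (hZ : hausdorff_space Z).
Variables (h : Z -> Z) (hh : local_homeo h).
Local Notation C := (cfun R cZ).
Local Notation X := (graph_corr R cZ hZ hh).

(** Each bump is supported in an open set where h is injective, so it cannot be nonzero at two
    points of one fibre. Compactness leaves finitely many bumps without common zero. *)
Lemma locally_injective_bumps : exists (r : seq Z) (u : Z -> Z -> R),
  [/\ forall i, continuous (u i),
      forall i w v, h w = h v -> w != v -> u i w * u i v = 0 &
      forall w, exists2 i, i \in r & u i w != 0].
Proof.
have [z0 _] := Z0.
have bump z : exists u : Z -> R, [/\ continuous u, u z != 0 &
    forall w v, h w = h v -> w != v -> u w * u v = 0].
  have [U [g [oU Uz _ hg _]]] := hh z.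
  have clU : closed (~` U) by exact: open_closedC.
  have nUz : ~ (~` U) z by apply.
  have regZ := normal_completely_regular (R := R)
    (compact_normal hZ cZ) (hausdorff_accessible hZ).
  have /(@uniform_separatorP _ R)[f [cf _ f0 f1]] := regZ z _ clU nUz.
  (* The separating function f is 0 at z and 1 off U, so 1 - f is the bump. *)
  exists (fun w => 1 - f w); split.
  - by move=> w; apply: cvgB; [exact: cvg_cst|exact: cf].
  - by rewrite (f0 (f z)) ?subr0 ?oner_eq0//; exists z.
  have out w : ~ U w -> 1 - f w = 0.
    by move=> nUw; rewrite (f1 (f w)) ?subrr//; exists w.
  move=> w v hwv /eqP wv.
  have [Uw|/out->] := pselect (U w); last by rewrite mul0r.
  have [Uv|/out->] := pselect (U v); last by rewrite mulr0.
  by exfalso; apply: wv; rewrite -(hg w) ?inE// hwv hg ?inE.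
have {bump}[u uP] := choice bump.
pose T : ptopologicalType := HB.pack Z (isPointed.Build Z z0).
have : @compact T [set: Z] := cZ.
rewrite compact_cover => /(_ Z setT (fun i => [set w | u i w != 0])).
case=> [i _|w _|D _ cov].
- have -> : [set w | u i w != 0] = u i @^-1` [set~ 0].
    by apply/seteqP; split=> w /= /eqP.
  apply: open_comp; first by move=> w _; have [cu _ _] := uP i; exact: cu.
  apply: closed_openC.
  exact: accessible_closed_set1 (hausdorff_accessible (@norm_hausdorff _ R)) 0.
- by exists w => //=; have [] := uP w.
exists (D : seq Z), u; split.
- by move=> i; have [] := uP i.
- by move=> i; have [] := uP i.
- by move=> w; have [i Di uw] := cov w I; exists i.
Qed.

(* A substitute for a partition of unity by squares: x_i = u_i and
   y_i = u_i / sum_j u_j^2 for bumps u_i supported where h is injective. *)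
Lemma fibre_dual_families : exists s : seq (C * C), forall w v, h w = h v ->
  \sum_(p <- s) p.1 w * conjc (p.2 v) = (w == v)%:R.
Proof.
have [r [u [cu inj cov]]] := locally_injective_bumps.
pose S w := \sum_(i <- r) u i w ^+ 2.
have S0 w : S w != 0.
  have [i ir uw] := cov w; rewrite /S psumr_neq0; last by move=> *; exact: sqr_ge0.
  by apply/hasP; exists i => //=; rewrite lt_neqAle sqr_ge0 eq_sym sqrf_eq0 uw.
have cS : continuous S.
  move=> w; apply: cvg_big => [|i _]; first exact: add_continuous.
  by rewrite expr2; apply: cvgM; exact: cu.
have cuS i : continuous (fun w => u i w / S w).
  move=> w; apply: cvgM; first exact: cu.
  by apply: cvgV; [exact: S0|exact: cS].
exists [seq (mkcfun cZ (continuous_realC (cu i)), mkcfun cZ (continuous_realC (cuS i)))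
       | i <- r].
move=> w v hwv; rewrite big_map.
under eq_bigr do rewrite !mkcfunE conjc_real -rmorphM/= mulrA.
rewrite -rmorph_sum/= -mulr_suml.
have [<-|wv] := eqVneq w v.
  by rewrite (_ : \sum_(i <- r) _ = S w) ?divff.
by rewrite big1 ?mul0r// => i _; exact: inj.
Qed.

Lemma graph_hinnerE (x y : X) z : (hinner x y : C) z =
  \sum_(w <- fset_set (h @^-1` [set z])) conjc ((x : C) w) * (y : C) w.
Proof. exact: (fibre_sumE cZ hZ hh). Qed.

(** The Ruelle transfer operator with trivial weight; as an inner product with the constant 1 it
    inherits continuity of its values. *)
Definition transfer (a : C) : C := hinner (cfun_cst cZ 1 : X) (a : X).

Lemma transferE a z : transfer a z = \sum_(w <- fset_set (h @^-1` [set z])) a w.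
Proof.
rewrite /transfer graph_hinnerE; apply: eq_bigr => w _.
by rewrite mkcfunE conjc1 mul1r.
Qed.

(** Both claims follow by exchanging the frame sum with the fibre sum: the duality relation on a
    fibre gives reconstruction, and its diagonal case w = v gives the transfer operator. *)
Lemma graph_frame : exists2 s : seq (X * X), frame s &
  forall a, \sum_(p <- s) hinner p.2 (hlact a p.1 : X) = transfer a.
Proof.
have [s sE] := fibre_dual_families; exists s => [x|a].
  apply/cfunP => w; apply/esym.
  transitivity (\sum_(p <- s) \sum_(v <- fset_set (h @^-1` [set h w]))
      (p.1 : C) w * conjc ((p.2 : C) v) * (x : C) v).
    rewrite (cfun_sumE (cZ := cZ)); apply: eq_bigr => p _.
    transitivity ((p.1 : C) w * (hinner (p.2 : X) x : C) (h w)); first by [].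
    by rewrite graph_hinnerE mulr_sumr; apply: eq_bigr => v _; rewrite mulrA.
  have fw : w \in fset_set (h @^-1` [set h w]).
    by rewrite in_fset_set ?inE//; exact: local_homeo_finite_fibre.
  (* On the fibre through w only the term v = w survives. *)
  rewrite exchange_big (big_rem w fw)/= -mulr_suml sE// eqxx mul1r.
  rewrite big_seq big1 ?addr0// => v; rewrite mem_rem_uniq ?fset_uniq// inE => /andP[vw].
  rewrite in_fset_set; last exact: local_homeo_finite_fibre.
  rewrite inE => /= hv; rewrite -mulr_suml sE// (negbTE (_ : w != v)) ?mul0r//.
  by rewrite eq_sym.
apply/cfunP => z; rewrite (cfun_sumE (cZ := cZ)) transferE.
under eq_bigr do rewrite graph_hinnerE.
rewrite exchange_big; apply: eq_bigr => w _ /=.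
transitivity (a w * \sum_(p <- s) (p.1 : C) w * conjc ((p.2 : C) w)).
  rewrite mulr_sumr; apply: eq_bigr => p _.
  transitivity (conjc ((p.2 : C) w) * (a w * (p.1 : C) w)); first by [].
  by rewrite mulrCA [conjc _ * _]mulrC.
by rewrite sE// eqxx mulr1.
Qed.

Lemma graph_unit : bimodule_unit X (cfun_cst cZ 1).
Proof.
split; first by apply/cfunP => z; rewrite cfun_starE; exact: conjc1.
- exact: cfun_unit.
- by move=> x; exact: (cfun_unit _).1.
- by move=> x; apply/cfunP => z; exact: mulr1.
Qed.

(** [fset_set] is empty by convention on infinite sets; finiteness makes [fibre_card] a true
    cardinality. *)
Lemma iter_fibre_finite n z : finite_set (iter n h @^-1` [set z]).
Proof.
elim: n z => [|n IH] z; first exact: (finite_set1 z).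
apply: (@sub_finite_set _ _ (\bigcup_(w in h @^-1` [set z]) iter n h @^-1` [set w])).
  by move=> v /= hv; exists (iter n h v).
by apply: bigcup_finite => [|w _]; [exact: local_homeo_finite_fibre|exact: IH].
Qed.

(** The fibre of the iterate n + 1 over z is partitioned by the image of its points under the
    iterate n, which lies in the fibre of h over z. *)
Lemma fibre_cardS n z :
  fibre_card h n.+1 z = (\sum_(w <- fset_set (h @^-1` [set z])) fibre_card h n w)%N.
Proof.
have fibE m y v : (v \in fset_set (iter m h @^-1` [set y])) = (iter m h v == y).
  by rewrite in_fset_set; [apply/idP/eqP; rewrite inE|exact: iter_fibre_finite].
pose A := fset_set (iter n.+1 h @^-1` [set z]).
have subA w : h w = z -> fset_set (iter n h @^-1` [set w]) =
    [fset v in A | iter n h v == w]%fset.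
  move=> hw; apply/fsetP => v; rewrite !inE/= !fibE /=.
  by have [->|] := eqVneq; rewrite ?hw ?eqxx ?andbF.
have fh w : (w \in fset_set (h @^-1` [set z])) = (h w == z) := fibE 1%N z w.
(* Double counting: each v in A meets exactly one w. *)
transitivity (\sum_(v <- A) \sum_(w <- fset_set (h @^-1` [set z]) | iter n h v == w) 1)%N.
  rewrite /fibre_card card_fset_sum1 [LHS]big_seq [RHS]big_seq; apply: eq_bigr => v.
  rewrite fibE /= => hv; rewrite (big_rem (iter n h v)) ?fh//= eqxx.
  rewrite big_seq_cond big1 ?addn0// => w; rewrite mem_rem_uniq ?fset_uniq// inE.
  by rewrite eq_sym andbAC => /andP[/andP[/negbTE->]].
rewrite (exchange_big_dep xpredT)//= [LHS]big_seq [RHS]big_seq; apply: eq_bigr => w.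
rewrite fh => /eqP hw; rewrite /fibre_card subA// card_fset_sum1.
exact: big_fset_condE.
Qed.

Lemma transfer_iter n z : iter n transfer (cfun_cst cZ 1) z = (fibre_card h n z)%:R.
Proof.
elim: n z => [|n IH] z.
  by rewrite /fibre_card /= (_ : id @^-1` [set z] = [set z])// fset_set1 cardfs1.
rewrite iterS transferE fibre_cardS natr_sum.
by apply: eq_bigr => w _; exact: IH.
Qed.

(** The cardinalities are the values of L^n 1, a continuous function on a compact space, so they are
    bounded and a maximum exists; [xget] then does not fall back on its default 0. *)
Lemma fibre_card_max n z : (fibre_card h n z <= max_fibre_card h n)%N.
Proof.
have [M HM] := cfun_bounded (iter n transfer (cfun_cst cZ 1)).
have ubP m : `[< exists y, fibre_card h n y = m >] -> (m <= Num.bound M)%N.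
  move=> /asboolP[y <-]; rewrite -(ler_nat R).
  have := HM y; rewrite transfer_iter => HMy.
  have nE : rnorm (fibre_card h n y)%:R = (fibre_card h n y)%:R :> R.
    by apply: complexI; rewrite complex_normE normr_nat rmorph_nat.
  move: HMy; rewrite nE => /le_trans; apply.
  by apply: ltW; exact: archi_boundP (le_trans (rnorm_ge0 _) (HM y)).
have exP : exists m, `[< exists y, fibre_card h n y = m >].
  by exists (fibre_card h n z); apply/asboolP; exists z.
have [m /asboolP[y ym] mP] := ex_maxnP exP ubP.
have [_ ] := xgetPex 0%N (ex_intro (fun m => (exists z, fibre_card h n z = m) /\
  forall z, (fibre_card h n z <= m)%N) m (conj (ex_intro _ y ym)
  (fun z => mP _ (introT (asboolP _) (ex_intro _ z erefl))))).
exact.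
Qed.

End GraphFrame.

(** * From the scaling relation to fibre growth *)

Theorem corollary5p3 (R : realType) (Z : topologicalType)
    (Z0 : [set: Z] !=set0) (cZ : compact [set: Z]) (hZ : hausdorff_space Z)
    (h : Z -> Z) (hh : local_homeo h) (hsurj : forall z, exists w, h w = z)
    (T : toeplitz_algebra (graph_corr R cZ hZ hh)) (O : cuntz_pimsner T)
    (gamma : R[i] -> O -> O) (hgamma : gauge_action gamma) (beta : R) :
  (exists phi : O -> R[i], kms_state (fun t : R => gamma (cis t)) beta phi) ->
  (beta%:E <= beta_c h R)%E.
Proof.
move=> [phi kms].
pose X := graph_corr R cZ hZ hh; pose L := transfer (R := R) (cZ := cZ) hZ hh.
pose one := cfun_cst cZ 1 : cfun R cZ.
pose pi := cp_quot O \o toep_pi T.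
have [s fs sL] := graph_frame R Z0 cZ hZ hh.
have uX : bimodule_unit X one := graph_unit R cZ hZ hh.
have p0 : 0 < phi (pi one) := kms_unit_gt0 kms uX.
have step a : phi (pi a) = (expR (- beta))%:C * phi (pi (L a)).
  by rewrite /pi (kms_scaling hgamma kms a fs uX) sL.
have iterate n : phi (pi one) = (expR (- beta *+ n))%:C * phi (pi (iter n L one)).
  elim: n => [|n ->]; first by rewrite mulr0n expR0 mul1r.
  by rewrite step mulrA -rmorphM -expRD iterS mulrSr.
have [_ [pil piM piS] _ _] := cp_rep O.
have [[phil phi0 _ _] _] := kms.
have bound n : phi (pi (iter n L one)) <= (max_fibre_card h n)%:R * phi (pi one).
  have [z|b bE] := @cfun_ge0_sqr _ _ cZ ((max_fibre_card h n)%:R *: one - iter n L one).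
    rewrite cfunBE cfunZE transfer_iter mkcfunE mulr1 subr_ge0 ler_nat.
    exact: (fibre_card_max R cZ hZ hh).
  have := phi0 (pi b); rewrite -piS -piM -bE (zmod_morphism_linear pil).
  by rewrite (scalable_linear pil) (zmod_morphism_linear phil) (scalable_linear phil) subr_ge0.
have growth n : expR (beta *+ n) <= (max_fibre_card h n)%:R.
  (* After multiplication by e^{-n beta} the left side is phi(pi(1)), which is positive and
     cancels. *)
  have := ler_wpM2l (_ : 0 <= (expR (- beta *+ n))%:C) (bound n).
  rewrite -iterate ler0c expR_ge0 => /(_ isT); rewrite mulrA -{1}[phi _]mul1r ler_pM2r//.
  rewrite -(rmorph_nat (@real_complex R)) -rmorphM -(rmorph1 (@real_complex R)) lecR.
  by rewrite mulNrn expRN mulrC ler_pdivlMr ?expR_gt0// mul1r.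
(* The upper limit is the infimum, over sets V containing all n >= N for some N, of suprema over V;
   one good index in each V suffices. *)
rewrite /beta_c /limn_esup limf_esupE; apply: le_ereal_inf_tmp => _ [V [N _ NV] <-].
(* The index N + 1 avoids n = 0, where the inverse is 0 by convention. *)
apply: (@le_trans _ _ ((N.+1)%:R^-1 * ln (max_fibre_card h N.+1)%:R)%:E); last first.
  by apply: ereal_sup_ubound; exists N.+1 => //; apply: NV; exact: leqnSn.
rewrite lee_fin mulrC ler_pdivlMr ?ltr0n// mulr_natr -[leLHS]expRK ler_ln ?posrE ?expR_gt0//.
by apply: lt_le_trans (growth _); exact: expR_gt0.
Qed.
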